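(* For every $n\in\mathbb C\setminus\mathbb Z_{\leq0}$, $\lambda\in\mathbb C$ and $\mu\in\mathbb C\setminus\{0\}$, the equation $$z^2E''+(nz+\mu(1-z^2))E'+(\lambda-\mu nz)E=0$$ has a nontrivial entire solution (a solution $E\not\equiv0$ holomorphic on $\mathbb C$) if and only if $\xi_{n-1}(\lambda,\mu)=0$.
   Context: The function $\xi_l(\lambda,\mu)$, $l=n-1\in\mathbb C\setminus\mathbb Z_{<0}$, is defined as follows. For $k\ge1$ put $$M_k=\begin{pmatrix}1+\frac{\lambda}{k(k+l)} & \frac{\mu^2}{k(k+l)}\\ 1&0\end{pmatrix},\qquad R_k=M_kM_{k+1}M_{k+2}\cdots$$ (the infinite matrix product converges), let $R_{k,ij}$ denote the matrix elements of $R_k$, and set $$\xi_l(\lambda,\mu)=\lambda R_{1,11}+\mu^2R_{1,21}.$$ *)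

(* Defs.v *)
From Stdlib Require Import Reals ZArith.
From Coquelicot Require Export Coquelicot.
Open Scope C_scope.

Definition nat_to_C (k : nat) : C := RtoC (INR k).

(** Values at [k = 0] are irrelevant: only [k >= 1] is used. *)
Definition M (l lambda mu : C) (k : nat) : matrix (T := C) 2 2 :=
  [ [ 1 + lambda / (nat_to_C k * (nat_to_C k + l)),
      mu ^ 2 / (nat_to_C k * (nat_to_C k + l)) ],
    [ RtoC 1, RtoC 0 ] ].

(** [M_k M_(k+1) ... M_(k+N-1)], new factors entering on the right. *)
Fixpoint partial_prod (l lambda mu : C) (k N : nat) : matrix (T := C) 2 2 :=
  match N with
  | O => Mone
  | S N' => Mmult (partial_prod l lambda mu k N') (M l lambda mu (k + N'))
  end.

(** Limit of a complex sequence; as for every use of [lim], the value is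
    meaningful when the sequence converges. *)
Definition C_lim_seq (u : nat -> C) : C :=
  lim (T := C_CompleteNormedModule) (filtermap u eventually).

(** The infinite product [M_k M_(k+1) ...], as an entrywise limit. *)
Definition R_inf (l lambda mu : C) (k : nat) : matrix (T := C) 2 2 :=
  mk_matrix 2 2 (fun i j =>
    C_lim_seq (fun N => coeff_mat (RtoC 0) (partial_prod l lambda mu k N) i j)).

(** [coeff_mat] numbers rows and columns from 0, so the entries 11 and 21
    are [0 0] and [1 0]. *)
Definition xi (l lambda mu : C) : C :=
  lambda * coeff_mat (RtoC 0) (R_inf l lambda mu 1) 0 0
  + mu ^ 2 * coeff_mat (RtoC 0) (R_inf l lambda mu 1) 1 0.

Definition entire (E : C -> C) : Prop := forall z : C, ex_derive E z.

(** [C_derive] is total, so being a solution includes the existence of the two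
    complex derivatives that occur in the equation. *)
Definition solution (n lambda mu : C) (E : C -> C) : Prop :=
  forall z : C,
    ex_derive E z /\ ex_derive (C_derive E) z /\
    z ^ 2 * C_derive (C_derive E) z
    + (n * z + mu * (1 - z ^ 2)) * C_derive E z
    + (lambda - mu * n * z) * E z = 0.

(* Main.v *)
Require Import Defs.
From Stdlib Require Import Reals ZArith Lra Lia FunctionalExtensionality.
From Coquelicot Require Import Coquelicot.
Open Scope C_scope.

(** Write [E = sum a_k z^k] and [a_k = (mu^k / k!) b_k].  The differential equation becomes
    [(b_(k-1), b_k)^T = M_k (b_k, b_(k+1))^T] for [k >= 1] together with
    [lambda b_0 + mu^2 b_1 = 0].  The sequence [m_k = R_(k+1),11] solves the recurrence and
    tends to 1, and [R_1,21 = m_1], so [xi = lambda m_0 + mu^2 m_1].  If [xi = 0], then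
    [b = m] gives an entire solution.  Conversely, the coefficients [a_k] of an entire
    solution are bounded, while the Casoratian of [b] and [m] grows so fast that it must
    vanish; hence [b] is proportional to [m] and [xi = 0].

    That an entire function is the sum of a power series is Cauchy's theorem; since the
    derivative of a solution is itself differentiable, hence continuous, it follows by
    contracting the circle of integration to a point and differentiating under the
    integral sign. *)

(** * Limits and derivatives in terms of the modulus *)

(** For [mu <> 0] the origin is an irregular singular point. With [l = n - 1], comparing
    coefficients of [z^k] gives [mu (k+1) a_(k+1) + (k (k+l) + lambda) a_k = mu (k+l) a_(k-1)], so
    for every [lambda] a formal power series solution exists and is unique up to a factor; the
    obstacle is its convergence. The relations with [k >= 1] have a two-dimensional solution space:
    one direction decays like [mu^k / k!], and every solution outside it grows factorially and has
    radius of convergence 0. The relation at [k = 0] selects a line in this space, the decaying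
    solution spans a line, and [xi = 0] says that the two lines coincide. Splitting off [mu^k / k!]
    turns decay into convergence to 1, which is what an infinite product of matrices tending to
    [[[1, 0], [1, 0]]] delivers. The hypothesis on [n] says that [k + l <> 0] for [k >= 1], so that
    the entries of [M_k] are genuine quotients. *)

Lemma locally_Cmod (x : C) (P : C -> Prop) :
  locally (T := C_UniformSpace) x P <->
  exists d : R, (0 < d)%R /\ forall y, (Cmod (y - x) < d)%R -> P y.
Proof.
  split.
  - intros [d Hd]. exists d; split; [apply cond_pos|].
    intros y Hy. apply Hd. now apply C_NormedModule_mixin_compat1.
  - intros [d [Hd H]].
    (* Balls of the product structure on [C] are squares; the square of half-side [d / sqrt 2] lies
       in the disc of radius [d]. *)
    assert (Hs : (0 < sqrt 2)%R) by (apply sqrt_lt_R0; lra).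
    assert (Hd2 : (0 < d / sqrt 2)%R) by (apply Rdiv_lt_0_compat; lra).
    exists (mkposreal _ Hd2). intros y Hy. apply H.
    apply C_NormedModule_mixin_compat2 in Hy. simpl in Hy.
    replace d with (sqrt 2 * (d / sqrt 2))%R by (field; lra). exact Hy.
Qed.

Lemma filterlim_Cmod {T} (F : (T -> Prop) -> Prop) {FF : Filter F} (u : T -> C) (l : C) :
  filterlim u F (locally (T := C_UniformSpace) l) <->
  forall eps : R, (0 < eps)%R -> F (fun t => (Cmod (u t - l) < eps)%R).
Proof.
  split.
  - intros H eps He. apply (H (fun y => (Cmod (y - l) < eps)%R)).
    apply locally_Cmod. now exists eps.
  - intros H P HP. apply locally_Cmod in HP. destruct HP as [d [Hd HP]].
    unfold filtermap. generalize (H d Hd). apply filter_imp. auto.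
Qed.

Lemma is_derive_Cmod (f : C -> C) (z l : C) :
  is_derive f z l <->
  forall eps : R, (0 < eps)%R -> exists d : R, (0 < d)%R /\
    forall h, (Cmod h < d)%R -> (Cmod (f (z + h)%C - f z - h * l) <= eps * Cmod h)%R.
Proof.
  split.
  - intros [_ H] eps He.
    specialize (H z (fun P HP => HP) (mkposreal eps He)).
    (* [is_derive] uses the neighbourhoods that [C] has as an absolute ring; [locally_C] exchanges
       them for those of the product structure. *)
    apply (proj2 (locally_C z _)) in H. apply locally_Cmod in H.
    destruct H as [d [Hd H]]. exists d; split; auto. intros h Hh.
    specialize (H (z + h)). simpl in H.
    replace (z + h - z) with h in H by ring. specialize (H Hh).
    unfold norm, minus, plus, opp, scal in H; simpl in H. unfold mult in H; simpl in H.
    unfold abs in H; simpl in H.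
    replace (f (z + h) - f z - h * l) with (f (z + h) + - f z + - ((z + h + - z) * l)) by ring.
    replace (Cmod h) with (Cmod (z + h + - z)) by (f_equal; ring). exact H.
  - intros H. split; [apply is_linear_scal_l|].
    intros x Hx. apply (is_filter_lim_locally_unique (V := AbsRing_NormedModule C_AbsRing)) in Hx. subst x.
    intros [eps He]. apply (proj1 (locally_C z _)), locally_Cmod.
    destruct (H eps He) as [d [Hd Hh]]. exists d; split; auto.
    intros y Hy. specialize (Hh (y - z) Hy).
    unfold norm, minus, plus, opp, scal; simpl. unfold mult; simpl. unfold abs; simpl.
    replace (z + (y - z)) with y in Hh by ring. exact Hh.
Qed.

Lemma is_derive_continuous_C (f : C -> C) (z l : C) :
  is_derive f z l -> continuous f z.
Proof.
  intros H. apply filterlim_Cmod; [apply locally_filter|]. intros eps He.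
  destruct (proj1 (is_derive_Cmod f z l) H 1%R Rlt_0_1) as [d [Hd Hh]].
  apply locally_Cmod.
  assert (Hl := Cmod_ge_0 l).
  exists (Rmin d (eps / (2 + Cmod l))); split.
  { apply Rmin_pos; auto. apply Rdiv_lt_0_compat; lra. }
  intros y Hy.
  assert (Hy1 := Rlt_le_trans _ _ _ Hy (Rmin_l _ _)).
  assert (Hy2 := Rlt_le_trans _ _ _ Hy (Rmin_r _ _)).
  specialize (Hh _ Hy1). replace (z + (y - z)) with y in Hh by ring.
  replace (f y - f z) with ((f y - f z - (y - z) * l) + (y - z) * l) by ring.
  eapply Rle_lt_trans; [apply Cmod_triangle|]. rewrite Cmod_mult.
  assert (Hp := Cmod_ge_0 (y - z)).
  apply (Rmult_lt_compat_r (2 + Cmod l)) in Hy2; [|lra].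
  unfold Rdiv in Hy2. rewrite Rmult_assoc, Rinv_l in Hy2 by lra. nra.
Qed.

(** [lim] is specified only on Cauchy filters. A convergent sequence generates one, so [lim] is a
    limit of it, and limits are unique. *)
Lemma C_lim_seq_unique (u : nat -> C) (l : C) :
  filterlim u eventually (locally (T := C_UniformSpace) l) -> C_lim_seq u = l.
Proof.
  intros H. unfold C_lim_seq.
  apply (filterlim_locally_unique (K := C_AbsRing) (V := C_NormedModule) (F := eventually) u); auto.
  apply filterlim_locally. intros eps.
  change (filtermap u eventually (ball (lim (T := C_CompleteNormedModule) (filtermap u eventually)) eps)).
  apply (complete_cauchy (T := C_CompleteNormedModule)).
  - apply filtermap_proper_filter. apply eventually_filter.
  - intros e. exists l. apply H. apply locally_ball.
Qed.

(** * Complex power series with infinite radius of convergence *)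

Definition Cseries (a : nat -> C) (l : C) : Prop :=
  is_series (K := C_AbsRing) (V := C_NormedModule) a l.

Lemma is_series_half_pow (M : R) : is_series (fun k => M * (/ 2) ^ k)%R (2 * M)%R.
Proof.
  replace (2 * M)%R with (scal M (/ (1 - / 2)))%R.
  - apply (is_series_scal (K := R_AbsRing) (V := R_NormedModule) M). apply is_series_geom.
    rewrite Rabs_pos_eq; lra.
  - unfold scal; simpl. unfold mult; simpl. field.
Qed.

Lemma Cseries_bound (a : nat -> C) (l : C) (M : R) :
  Cseries a l -> (forall k, (Cmod (a k) <= M * (/ 2) ^ k)%R) -> (Cmod l <= 2 * M)%R.
Proof.
  intros Ha Hb.
  assert (Hn : is_lim_seq (fun n => Cmod (sum_n a n)) (Cmod l)).
  { eapply filterlim_comp; [exact Ha|].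
    apply (filterlim_norm (K := C_AbsRing) (V := C_NormedModule)). }
  refine (is_lim_seq_le _ _ (Cmod l) (2 * M)%R _ Hn (is_series_half_pow M)).
  intros n. unfold sum_n.
  eapply Rle_trans; [apply (norm_sum_n_m (K := C_AbsRing) (V := C_NormedModule))|].
  now apply sum_n_m_le.
Qed.

Lemma Cseries_ex (a : nat -> C) (M : R) :
  (forall k, (Cmod (a k) <= M * (/ 2) ^ k)%R) -> exists l, Cseries a l.
Proof.
  intros Hb.
  apply (ex_series_le (K := C_AbsRing) (V := C_CompleteNormedModule) a
           (fun k => M * (/ 2) ^ k)%R).
  - exact Hb.
  - exists (2 * M)%R. apply is_series_half_pow.
Qed.

(** Cauchy's estimates at every radius, expressing an infinite radius of convergence. Doubling the
    radius turns bounded terms into terms dominated by a geometric series of ratio 1/2. *)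
Definition entire_coef (a : nat -> C) : Prop :=
  forall r : R, (1 <= r)%R -> exists M : R, forall k, (Cmod (a k) * r ^ k <= M)%R.

Definition PSC (a : nat -> C) (z : C) : C := C_lim_seq (sum_n (fun k => a k * z ^ k)).

Lemma PSC_unique (a : nat -> C) (z l : C) : Cseries (fun k => a k * z ^ k) l -> PSC a z = l.
Proof. apply C_lim_seq_unique. Qed.

Lemma entire_coef_term (a : nat -> C) (r : R) :
  entire_coef a -> (1 <= r)%R ->
  exists M : R, forall k, (Cmod (a k) * r ^ k <= M * (/ 2) ^ k)%R.
Proof.
  intros Ha Hr. destruct (Ha (r * 2)%R ltac:(lra)) as [M HM].
  exists M. intros k. specialize (HM k). rewrite Rpow_mult_distr in HM.
  assert (H2 : (0 < 2 ^ k)%R) by (apply pow_lt; lra).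
  rewrite pow_inv. apply (Rmult_le_reg_r (2 ^ k)); auto.
  rewrite (Rmult_assoc M), Rinv_l by lra. lra.
Qed.

Lemma PSC_correct (a : nat -> C) (z : C) :
  entire_coef a -> Cseries (fun k => a k * z ^ k) (PSC a z).
Proof.
  intros Ha.
  assert (Hz := Cmod_ge_0 z).
  destruct (entire_coef_term a (1 + Cmod z) Ha ltac:(lra)) as [M HM].
  destruct (Cseries_ex (fun k => a k * z ^ k) M) as [l Hl].
  - intros k. rewrite Cmod_mult, Cmod_pow. eapply Rle_trans; [|apply HM].
    apply Rmult_le_compat_l; [apply Cmod_ge_0|].
    apply pow_incr. lra.
  - now rewrite (PSC_unique _ _ _ Hl).
Qed.

Definition coef_deriv (a : nat -> C) (k : nat) : C := nat_to_C (S k) * a (S k).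

Definition coef_shift (a : nat -> C) (k : nat) : C :=
  match k with O => RtoC 0 | S j => a j end.

Lemma nat_to_C_S (k : nat) : nat_to_C (S k) = nat_to_C k + 1.
Proof. unfold nat_to_C. now rewrite S_INR, RtoC_plus. Qed.

Lemma Cmod_nat_to_C (k : nat) : Cmod (nat_to_C k) = INR k.
Proof. unfold nat_to_C. rewrite Cmod_R. apply Rabs_pos_eq, pos_INR. Qed.

Lemma nat_to_C_S_neq_0 (k : nat) : nat_to_C (S k) <> 0.
Proof. apply Cmod_gt_0. rewrite Cmod_nat_to_C. apply lt_0_INR. lia. Qed.

Lemma INR_le_pow2 (k : nat) : (INR k <= 2 ^ k)%R.
Proof.
  induction k; [simpl; lra|]. rewrite S_INR. simpl.
  assert (1 <= 2 ^ k)%R by (apply pow_R1_Rle; lra). lra.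
Qed.

(** The factor [k + 1 <= 2^(k+1)] is absorbed by the estimate at radius [2 r]. *)
Lemma entire_coef_deriv (a : nat -> C) : entire_coef a -> entire_coef (coef_deriv a).
Proof.
  intros Ha r Hr. destruct (Ha (2 * r)%R ltac:(lra)) as [M HM].
  exists M. intros k. unfold coef_deriv.
  rewrite Cmod_mult, Cmod_nat_to_C.
  eapply Rle_trans; [|apply (HM (S k))].
  rewrite Rpow_mult_distr.
  assert (H1 := INR_le_pow2 (S k)). assert (H2 := Cmod_ge_0 (a (S k))).
  assert (H3 : (1 <= r ^ k)%R) by (apply pow_R1_Rle; lra).
  assert (H0 := pos_INR (S k)).
  replace (INR (S k) * Cmod (a (S k)) * r ^ k)%R with (Cmod (a (S k)) * (INR (S k) * r ^ k))%R by ring.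
  apply Rmult_le_compat_l; auto.
  apply Rmult_le_compat; auto; try lra. simpl. nra.
Qed.

(** The remainder is quadratic in [h] with a constant geometric in [k], hence summable against
    entire coefficients: this is what permits termwise differentiation. At [k = 0] the value of
    [pred k] is harmless, since the factor [k] vanishes. *)
Lemma pow_taylor2 (z h : C) (k : nat) :
  (Cmod h <= 1)%R ->
  (Cmod ((z + h) ^ k - z ^ k - h * (nat_to_C k * z ^ pred k)) <=
     (Cmod h) ^ 2 * (2 * (1 + Cmod z)) ^ k)%R.
Proof.
  intros Hh. induction k as [|k IH].
  - simpl. unfold nat_to_C. simpl.
    replace (1 - 1 - h * (0 * 1)) with (RtoC 0) by ring. rewrite Cmod_0.
    assert (H := Cmod_ge_0 h). nra.
  - set (D := (z + h) ^ k - z ^ k - h * (nat_to_C k * z ^ pred k)) in *.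
    (* The remainder [D k] satisfies [D (k+1) = (z+h) D k + k h^2 z^(k-1)]. *)
    replace ((z + h) ^ S k - z ^ S k - h * (nat_to_C (S k) * z ^ pred (S k)))
      with ((z + h) * D + nat_to_C k * (h * h * z ^ pred k)).
    2: { unfold D. rewrite nat_to_C_S. destruct k as [|k].
         - unfold nat_to_C; simpl. ring.
         - simpl. ring. }
    eapply Rle_trans; [apply Cmod_triangle|]. rewrite !Cmod_mult, Cmod_nat_to_C, Cmod_pow.
    set (r := (1 + Cmod z)%R) in *.
    assert (Hz := Cmod_ge_0 z). assert (H0 := Cmod_ge_0 h).
    assert (Hr : (1 <= r)%R) by (unfold r; lra).
    assert (H1 : (Cmod (z + h) <= r)%R).
    { eapply Rle_trans; [apply Cmod_triangle|]. unfold r; lra. }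
    assert (H2 : (Cmod z ^ pred k <= r ^ k)%R).
    { eapply Rle_trans; [apply (pow_incr _ r); unfold r; lra|].
      apply Rle_pow; auto; lia. }
    assert (H3 := INR_le_pow2 k). assert (H4 := pos_INR k).
    assert (H5 := Cmod_ge_0 D). assert (H6 := Cmod_ge_0 (z + h)).
    rewrite Rpow_mult_distr in IH |- *.
    assert (H7 : (1 <= 2 ^ k)%R) by (apply pow_R1_Rle; lra).
    assert (H8 : (1 <= r ^ k)%R) by (apply pow_R1_Rle; lra).
    assert (H9 : (0 <= Cmod z ^ pred k)%R) by (apply pow_le; lra).
    assert (E1 : (Cmod (z + h) * Cmod D <= r * (Cmod h ^ 2 * (2 ^ k * r ^ k)))%R).
    { apply Rmult_le_compat; auto. }
    assert (E2 : (INR k * (Cmod h * Cmod h * Cmod z ^ pred k) <=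
                  2 ^ k * (Cmod h * Cmod h * r ^ k))%R).
    { apply Rmult_le_compat; auto; try nra. }
    assert (E3 : (2 ^ k * (Cmod h * Cmod h * r ^ k) <= r * (Cmod h ^ 2 * (2 ^ k * r ^ k)))%R).
    { replace (2 ^ k * (Cmod h * Cmod h * r ^ k))%R with (1 * (Cmod h ^ 2 * (2 ^ k * r ^ k)))%R by ring.
      apply Rmult_le_compat_r; auto.
      apply Rmult_le_pos; nra. }
    simpl. simpl in E1, E3. lra.
Qed.

Lemma Cseries_ext (a b : nat -> C) (l m : C) :
  (forall k, a k = b k) -> l = m -> Cseries a l -> Cseries b m.
Proof. intros H <-. now apply is_series_ext. Qed.

Lemma Cseries_plus (a b : nat -> C) (l m : C) :
  Cseries a l -> Cseries b m -> Cseries (fun k => a k + b k) (l + m).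
Proof. apply (is_series_plus (V := C_NormedModule)). Qed.

Lemma Cseries_scal (c : C) (a : nat -> C) (l : C) :
  Cseries a l -> Cseries (fun k => c * a k) (c * l).
Proof. apply (is_series_scal (K := C_AbsRing) (V := C_NormedModule)). Qed.

Lemma Cseries_incr (a : nat -> C) (l : C) :
  Cseries a l -> Cseries (fun k => a (S k)) (l - a O).
Proof.
  intros H. apply (is_series_incr_1 (V := C_NormedModule)).
  change (Cseries a (l - a O + a O)).
  now replace (l - a O + a O) with l by ring.
Qed.

Lemma Cseries_decr (a : nat -> C) (l : C) :
  Cseries (fun k => a (S k)) l -> Cseries a (l + a O).
Proof.
  intros H. apply (is_series_decr_1 (V := C_NormedModule)).
  change (Cseries (fun k => a (S k)) (l + a O + - a O)).
  now replace (l + a O + - a O) with l by ring.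
Qed.

Lemma Cseries_head (a : nat -> C) : (forall k, a (S k) = 0) -> Cseries a (a O).
Proof.
  intros H.
  destruct (Cseries_ex (fun k => a (S k)) 0) as [s Hs].
  { intros k. rewrite H, Cmod_0. lra. }
  apply (Cseries_ext _ _ _ _ (fun k => eq_refl) (Cplus_0_l (a O))).
  apply Cseries_decr.
  apply (Cseries_ext (fun k => 0 * a (S k)) _ (0 * s)).
  - intros k. rewrite H. ring.
  - ring.
  - now apply Cseries_scal.
Qed.

Lemma Cseries_shift (a : nat -> C) (z l : C) :
  Cseries (fun k => a k * z ^ k) l ->
  Cseries (fun k => coef_shift a k * z ^ k) (z * l).
Proof.
  intros H.
  refine (Cseries_ext _ _ _ _ (fun k => eq_refl) _
           (Cseries_decr (fun k => coef_shift a k * z ^ k) (z * l) _)).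
  - simpl. ring.
  - refine (Cseries_ext _ _ _ _ _ eq_refl (Cseries_scal z _ _ H)).
    intros k. simpl. ring.
Qed.

Lemma is_derive_PSC (a : nat -> C) (z : C) :
  entire_coef a -> is_derive (PSC a) z (PSC (coef_deriv a) z).
Proof.
  intros Ha. apply is_derive_Cmod.
  assert (Hz := Cmod_ge_0 z).
  destruct (entire_coef_term a (2 * (1 + Cmod z)) Ha ltac:(lra)) as [M HM].
  assert (HM0 : (0 <= M)%R).
  { specialize (HM O). simpl in HM. assert (H := Cmod_ge_0 (a O)). lra. }
  (* The summed remainders are at most [2 M |h|^2]; the [+ 1] keeps the denominator positive when
     [M = 0]. *)
  intros eps He. exists (Rmin 1 (eps / (2 * M + 1))). split.
  { apply Rmin_pos; [lra|]. apply Rdiv_lt_0_compat; lra. }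
  intros h Hh.
  assert (Hh1 := Rlt_le_trans _ _ _ Hh (Rmin_l _ _)).
  assert (Hh2 := Rlt_le_trans _ _ _ Hh (Rmin_r _ _)).
  assert (H0 := Cmod_ge_0 h).
  assert (S1 := PSC_correct a (z + h) Ha).
  assert (S2 := PSC_correct a z Ha).
  assert (S3 := Cseries_shift _ _ _ (PSC_correct (coef_deriv a) z (entire_coef_deriv a Ha))).
  (* The derived series is reindexed, with a zero term in front, so that it lines up term by term
     with the other two series. *)
  assert (S3' : Cseries (fun k => nat_to_C k * a k * z ^ pred k) (PSC (coef_deriv a) z)).
  { refine (Cseries_ext _ _ _ _ (fun k => eq_refl) _
      (Cseries_decr (fun k => nat_to_C k * a k * z ^ pred k) (PSC (coef_deriv a) z)
        (PSC_correct _ _ (entire_coef_deriv a Ha)))).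
    unfold nat_to_C; simpl. ring. }
  clear S3.
  assert (S4 := Cseries_plus _ _ _ _ S1 (Cseries_plus _ _ _ _ (Cseries_scal (-(1)) _ _ S2)
       (Cseries_scal (- h) _ _ S3'))).
  apply Rle_trans with (2 * (Cmod h ^ 2 * M))%R.
  - replace (PSC a (z + h) - PSC a z - h * PSC (coef_deriv a) z)
      with (PSC a (z + h) + (- (1) * PSC a z + - h * PSC (coef_deriv a) z)) by ring.
    apply (Cseries_bound _ _ _ S4). intros k.
    replace (a k * (z + h) ^ k + (- (1) * (a k * z ^ k) + - h * (nat_to_C k * a k * z ^ pred k)))
      with (a k * ((z + h) ^ k - z ^ k - h * (nat_to_C k * z ^ pred k))) by ring.
    rewrite Cmod_mult.
    assert (H1 := pow_taylor2 z h k ltac:(lra)). specialize (HM k).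
    assert (H2 := Cmod_ge_0 (a k)).
    eapply Rle_trans; [apply Rmult_le_compat_l; [auto | exact H1]|].
    replace (Cmod (a k) * (Cmod h ^ 2 * (2 * (1 + Cmod z)) ^ k))%R
      with (Cmod h ^ 2 * (Cmod (a k) * (2 * (1 + Cmod z)) ^ k))%R by ring.
    rewrite Rmult_assoc. apply Rmult_le_compat_l; [nra | auto].
  - apply (Rmult_lt_compat_r (2 * M + 1)) in Hh2; [|lra].
    unfold Rdiv in Hh2. rewrite Rmult_assoc, Rinv_l in Hh2 by lra. nra.
Qed.

(** Letting [z] tend to 0 gives [a 0 = 0]; dividing by [z] shifts the sequence and the induction
    goes on. The disc is punctured because the division gives no information at [z = 0]. *)
Lemma Cseries_unique0 (a : nat -> C) (M : R) :
  (forall k, (Cmod (a k) <= M)%R) ->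
  (forall z, (0 < Cmod z < 1)%R -> Cseries (fun k => a k * z ^ k) 0) ->
  forall k, a k = 0.
Proof.
  intros Hb H k. revert a Hb H.
  assert (H0 : forall a : nat -> C, (forall k, (Cmod (a k) <= M)%R) ->
    (forall z, (0 < Cmod z < 1)%R -> Cseries (fun k => a k * z ^ k) 0) -> a O = 0).
  { intros a Hb H. apply Cmod_eq_0. apply Rle_antisym; [|apply Cmod_ge_0].
    assert (HM : (0 <= M)%R). { generalize (Cmod_ge_0 (a O)) (Hb O). lra. }
    apply le_epsilon. intros eps He.
    (* At the real point [t] the terms after the first sum to [- a 0]. Since [t <= 1/2], they are
       dominated by [t M / 2^j], so [|a 0| <= 2 t M <= eps]. *)
    set (t := Rmin (/ 2) (eps / (2 * M + 1))).
    assert (Ht : (0 < t)%R). { apply Rmin_pos; [lra|]. apply Rdiv_lt_0_compat; lra. }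
    assert (Ht1 : (t <= / 2)%R) by apply Rmin_l.
    assert (Ht2 : (t <= eps / (2 * M + 1))%R) by apply Rmin_r.
    assert (Hc : Cmod (RtoC t) = t) by (rewrite Cmod_R; apply Rabs_pos_eq; lra).
    assert (S := Cseries_incr _ _ (H (RtoC t) ltac:(rewrite Hc; lra))).
    apply (Cseries_bound _ _ (t * M)) in S.
    - assert (E : 0 - a O * RtoC t ^ 0 = - a O) by (simpl; ring).
      cbv beta in S. rewrite E, Cmod_opp in S. rewrite Rplus_0_l. eapply Rle_trans; [exact S|].
      apply (Rmult_le_compat_r (2 * M + 1)) in Ht2; [|lra].
      unfold Rdiv in Ht2. rewrite Rmult_assoc, Rinv_l in Ht2 by lra. nra.
    - intros j. rewrite Cmod_mult, Cmod_pow, Hc. simpl.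
      assert (E : (t ^ j <= (/ 2) ^ j)%R) by (apply pow_incr; lra).
      assert (0 <= t ^ j)%R by (apply pow_le; lra).
      assert (E2 := Hb (Datatypes.S j)). assert (E3 := Cmod_ge_0 (a (Datatypes.S j))).
      replace (t * M * (/ 2) ^ j)%R with (M * (t * (/ 2) ^ j))%R by ring.
      apply Rmult_le_compat; try nra. }
  induction k as [|k IH]; intros a Hb H; [now apply H0|].
  assert (Ha0 := H0 a Hb H).
  apply (IH (fun k => a (S k))); [auto|].
  intros z Hz.
  assert (Hz0 : z <> 0) by (apply Cmod_gt_0; lra).
  refine (Cseries_ext _ _ _ _ _ _ (Cseries_scal (/ z) _ _ (Cseries_incr _ _ (H z Hz)))).
  - intros j. simpl. field. auto.
  - simpl. rewrite Ha0. ring.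
Qed.

(** * The infinite matrix product *)

Lemma coeff_mat_Mmult2 (A B : matrix (T := C) 2 2) (i j : nat) :
  (i < 2)%nat -> (j < 2)%nat ->
  coeff_mat (RtoC 0) (Mmult A B) i j =
  coeff_mat (RtoC 0) A i 0 * coeff_mat (RtoC 0) B 0 j
  + coeff_mat (RtoC 0) A i 1 * coeff_mat (RtoC 0) B 1 j.
Proof.
  intros Hi Hj. unfold Mmult. rewrite (coeff_mat_bij (RtoC 0)) by auto.
  simpl pred. rewrite sum_Sn, sum_O. reflexivity.
Qed.

(** Products starting at [k] and at [k + 1] are compared by a factor on the left, whereas
    [partial_prod] grows on the right. *)
Lemma partial_prod_cons (l lambda mu : C) (k N : nat) :
  partial_prod l lambda mu k (S N) =
  Mmult (M l lambda mu k) (partial_prod l lambda mu (S k) N).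
Proof.
  induction N as [|N IH].
  - simpl. rewrite Nat.add_0_r. now rewrite Mmult_one_l, Mmult_one_r.
  - change (partial_prod l lambda mu k (S (S N))) with
      (Mmult (partial_prod l lambda mu k (S N)) (M l lambda mu (k + S N))).
    rewrite IH, <- Mmult_assoc. simpl partial_prod at 2.
    now replace (k + S N)%nat with (S k + N)%nat by lia.
Qed.

Lemma one_plus_le_exp (a b d u : R) :
  (0 <= d)%R -> (d <= a - b)%R -> (0 <= u)%R -> ((1 + d) * u <= exp (a - b) * u)%R.
Proof.
  intros Hd H Hu. apply Rmult_le_compat_r; auto.
  generalize (exp_ineq1_le (a - b)). lra.
Qed.

(* [T 0 - T N] dominates the first [N] coefficients: [T] plays the role of the tail sums. *)
Lemma three_term_limit (alpha beta x y : nat -> C) (T : nat -> R) :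
  x O = 1 -> y O = 0 ->
  (forall N, x (S N) = x N * (1 + alpha N) + y N) ->
  (forall N, y (S N) = x N * beta N) ->
  (forall N, (Cmod (alpha N) + Cmod (beta N) <= T N - T (S N))%R) ->
  (forall N, (0 <= T N)%R) -> is_lim_seq T 0 ->
  exists m, filterlim x eventually (locally (T := C_UniformSpace) m) /\
    (Cmod (m - 1) <= exp (T O) * T O)%R.
Proof.
  intros x0 y0 xS yS HT T0 Tlim.
  (* Each step enlarges [|x| + |y|] by at most [1 + |alpha| + |beta| <= exp (T N - T (N+1))], and
     the exponents telescope. *)
  assert (Hu : forall N, (Cmod (x N) + Cmod (y N) <= exp (T O - T N))%R).
  { induction N as [|N IH].
    - rewrite x0, y0, Cmod_1, Cmod_0, Rminus_diag. rewrite exp_0. lra.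
    - rewrite xS, yS.
      replace (T O - T (S N))%R with ((T N - T (S N)) + (T O - T N))%R by ring.
      rewrite exp_plus.
      assert (A1 := Cmod_ge_0 (alpha N)). assert (A2 := Cmod_ge_0 (beta N)).
      assert (A3 := Cmod_ge_0 (x N)). assert (A4 := Cmod_ge_0 (y N)).
      apply Rle_trans with ((1 + (Cmod (alpha N) + Cmod (beta N))) * (Cmod (x N) + Cmod (y N)))%R.
      + rewrite Cmod_mult.
        assert (Cmod (x N * (1 + alpha N) + y N) <= Cmod (x N) * (1 + Cmod (alpha N)) + Cmod (y N))%R.
        { eapply Rle_trans; [apply Cmod_triangle|]. rewrite Cmod_mult.
          apply Rplus_le_compat_r, Rmult_le_compat_l; auto.
          eapply Rle_trans; [apply Cmod_triangle|]. rewrite Cmod_1. lra. }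
        nra.
      + eapply Rle_trans; [apply (one_plus_le_exp (T N) (T (S N))); [lra | apply HT | lra]|].
        apply Rmult_le_compat_l; auto. left; apply exp_pos. }
  set (U := exp (T O)).
  assert (HU : (0 < U)%R) by apply exp_pos.
  assert (Hx : forall N, (Cmod (x N) <= U)%R).
  { intros N. assert (A4 := Cmod_ge_0 (y N)). specialize (Hu N).
    apply Rle_trans with (exp (T O - T N)); [lra|]. unfold U.
    destruct (T0 N) as [H|H].
    - left. apply exp_increasing. lra.
    - rewrite <- H, Rminus_0_r. lra. }
  (* The sum is the slowly varying quantity: [v (N+1) - v N = x N (alpha N + beta N)], with no
     contribution of [y]. *)
  set (v := fun N => x N + y N).
  assert (Hv : forall N p, (Cmod (v (p + N)%nat - v N) <= U * (T N - T (p + N)%nat))%R).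
  { intros N p. induction p as [|p IH].
    - simpl. replace (v N - v N) with (RtoC 0) by ring. rewrite Cmod_0. lra.
    - simpl. set (n := (p + N)%nat) in *.
      replace (v (S n) - v N) with ((v n - v N) + x n * (alpha n + beta n)).
      2: { unfold v. rewrite xS, yS. ring. }
      eapply Rle_trans; [apply Cmod_triangle|]. rewrite Cmod_mult.
      assert (A1 := Cmod_triangle (alpha n) (beta n)). specialize (HT n).
      assert (A3 := Cmod_ge_0 (alpha n + beta n)).
      assert (Cmod (x n) * Cmod (alpha n + beta n) <= U * (T n - T (S n)))%R.
      { apply Rmult_le_compat; auto; [apply Cmod_ge_0 | lra]. }
      lra. }
  assert (Ht : forall eps, (0 < eps)%R -> exists N, forall n, (N <= n)%nat -> (U * T n < eps)%R).
  { intros eps He. apply is_lim_seq_spec in Tlim.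
    assert (He' : (0 < eps / U)%R) by (apply Rdiv_lt_0_compat; lra).
    destruct (Tlim (mkposreal _ He')) as [N HN]. exists N. intros n Hn.
    specialize (HN n Hn). simpl in HN. rewrite Rminus_0_r, Rabs_pos_eq in HN by auto.
    apply (Rmult_lt_compat_l U) in HN; auto.
    now replace (U * (eps / U))%R with eps in HN by (field; lra). }
  assert (Hc : exists m, filterlim v eventually (locally (T := C_CompleteNormedModule) m)).
  { apply (proj1 (filterlim_locally_cauchy (U := C_CompleteNormedModule) (F := eventually) v)).
    intros eps.
    destruct (Ht (eps / 2)%R) as [N HN]; [generalize (cond_pos eps); lra|].
    exists (fun n => (N <= n)%nat). split; [now exists N|].
    intros p q Hp Hq. apply C_NormedModule_mixin_compat1.
    assert (E : forall q, (N <= q)%nat -> (Cmod (v q - v N) < eps / 2)%R).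
    { intros j Hj. replace j with (j - N + N)%nat by lia.
      eapply Rle_lt_trans; [apply Hv|].
      specialize (HN N (Nat.le_refl _)). generalize (T0 (j - N + N)%nat). nra. }
    change (Cmod (v q - v p) < eps)%R.
    replace (v q - v p) with ((v q - v N) + - (v p - v N)) by ring.
    eapply Rle_lt_trans; [apply Cmod_triangle|]. rewrite Cmod_opp.
    generalize (E p Hp) (E q Hq). lra. }
  destruct Hc as [m Hm]. exists m.
  assert (Hm' := proj1 (filterlim_Cmod eventually v m) Hm).
  split.
  (* [x] and [v] differ by [y], and [y (n+1) = x n * beta n] is at most [U * T n], which tends to
     0. *)
  - apply filterlim_Cmod; [apply eventually_filter|]. intros eps He.
    destruct (Hm' (eps / 2)%R ltac:(lra)) as [N1 H1].
    destruct (Ht (eps / 2)%R ltac:(lra)) as [N2 H2].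
    exists (S (N1 + N2)). intros [|n] Hn; [lia|].
    replace (x (S n) - m) with ((v (S n) - m) + - y (S n)) by (unfold v; ring).
    eapply Rle_lt_trans; [apply Cmod_triangle|]. rewrite Cmod_opp.
    specialize (H1 (S n) ltac:(lia)). specialize (H2 n ltac:(lia)).
    rewrite yS, Cmod_mult.
    assert (A1 := Cmod_ge_0 (alpha n)). assert (A2 := Cmod_ge_0 (beta n)).
    specialize (HT n). specialize (Hx n). assert (A3 := T0 (S n)). assert (A4 := Cmod_ge_0 (x n)).
    assert (Cmod (x n) * Cmod (beta n) <= U * T n)%R by (apply Rmult_le_compat; lra).
    lra.
  - apply le_epsilon. intros eps He. destruct (Hm' eps He) as [N HN].
    specialize (HN (N + 0)%nat ltac:(lia)). specialize (Hv O N).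
    replace (m - 1) with (- (v (N + 0)%nat - m) + (v (N + 0)%nat - v O))
      by (unfold v; rewrite x0, y0; ring).
    eapply Rle_trans; [apply Cmod_triangle|]. rewrite Cmod_opp.
    generalize (T0 (N + 0)%nat). fold U. nra.
Qed.

(** For large [k] the term [k] dominates [l]; the finitely many other indices only need
    [k + l <> 0]. The form [k + 1] gives [1 / |k (k+l)| <= K / (k (k+1))], whose sums telescope. *)
Lemma linear_growth_bound (l : C) :
  (forall k, (1 <= k)%nat -> nat_to_C k + l <> 0) ->
  exists K, (0 <= K)%R /\
    forall k, (1 <= k)%nat -> (INR k + 1 <= K * Cmod (nat_to_C k + l))%R.
Proof.
  intros Hl.
  assert (Hfin : forall N, exists K, (2 <= K)%R /\ forall k, (1 <= k < N)%nat ->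
     (INR k + 1 <= K * Cmod (nat_to_C k + l))%R).
  { induction N as [|N [K [HK IH]]].
    - exists 2%R. split; [lra|]. intros; lia.
    - destruct N as [|N].
      + exists 2%R. split; [lra|]. intros; lia.
      + set (c := Cmod (nat_to_C (S N) + l)).
        assert (Hc : (0 < c)%R) by (apply Cmod_gt_0, Hl; lia).
        exists (K + (INR (S N) + 1) / c)%R.
        assert (H0 : (0 <= (INR (S N) + 1) / c)%R).
        { apply Rmult_le_pos; [generalize (pos_INR (S N)); lra|].
          left; now apply Rinv_0_lt_compat. }
        split; [lra|]. intros k Hk. rewrite Rmult_plus_distr_r.
        destruct (Nat.eq_dec k (S N)) as [->|Hne].
        * fold c. replace ((INR (S N) + 1) / c * c)%R with (INR (S N) + 1)%R by (field; lra). nra.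
        * specialize (IH k ltac:(lia)). assert (H1 := Cmod_ge_0 (nat_to_C k + l)). nra. }
  assert (H0 := Cmod_ge_0 l).
  (* Beyond this threshold [|k + l| >= (k + 1) / 2], so any [K >= 2] serves there. *)
  destruct (nfloor_ex (2 * Cmod l + 1) ltac:(lra)) as [N HN].
  destruct (Hfin (S N)) as [K [HK H]]. exists K; split; [lra|].
  intros k Hk. destruct (Nat.lt_ge_cases k (S N)) as [Hlt|Hge]; [apply H; lia|].
  apply le_INR in Hge. rewrite S_INR in Hge.
  assert (H1 : (INR k <= Cmod (nat_to_C k + l) + Cmod l)%R).
  { rewrite <- (Cmod_nat_to_C k), <- (Cmod_opp l).
    eapply Rle_trans; [|apply Cmod_triangle]. apply Req_le. f_equal. ring. }
  nra.
Qed.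

(* The entry 11 of [R_(k+1)]: the solution of the three-term recurrence below that tends to 1. *)
Definition minimal_sol (l lambda mu : C) (k : nat) : C :=
  coeff_mat (RtoC 0) (R_inf l lambda mu (S k)) 0 0.

(** [K] is uniform in [k]: the rate then yields both that the minimal solution is bounded and that
    it is nonzero for large [k]. *)
Lemma partial_prod_limit (l lambda mu : C) :
  (forall k, (1 <= k)%nat -> nat_to_C k + l <> 0) ->
  exists K, forall k,
    filterlim (fun N => coeff_mat (RtoC 0) (partial_prod l lambda mu (S k) N) 0 0)
      eventually (locally (T := C_UniformSpace) (minimal_sol l lambda mu k)) /\
    (Cmod (minimal_sol l lambda mu k - 1) <= K / (INR k + 1))%R.
Proof.
  intros Hl. destruct (linear_growth_bound l Hl) as [K0 [HK0 HK]].
  set (L := (Cmod lambda + Cmod (mu ^ 2))%R).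
  assert (HL : (0 <= L)%R).
  { generalize (Cmod_ge_0 lambda) (Cmod_ge_0 (mu ^ 2)). unfold L. lra. }
  set (Q := (L * K0)%R).
  assert (HQ : (0 <= Q)%R) by (apply Rmult_le_pos; auto).
  exists (exp Q * Q)%R. intros k.
  set (D := fun N => nat_to_C (S k + N) * (nat_to_C (S k + N) + l)).
  (* With [j = k + 1 + N], the two coefficients contribute at most
     [Q / (j (j+1)) = Q / j - Q / (j+1)]. *)
  set (T := fun N => (Q / (INR (S k + N)))%R).
  assert (Hk0 : forall N, (1 <= INR (S k + N))%R).
  { intros N. change 1%R with (INR 1). apply le_INR. lia. }
  destruct (three_term_limit (fun N => lambda / D N) (fun N => mu ^ 2 / D N)
    (fun N => coeff_mat (RtoC 0) (partial_prod l lambda mu (S k) N) 0 0)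
    (fun N => coeff_mat (RtoC 0) (partial_prod l lambda mu (S k) N) 0 1) T)
    as [m [Hm1 Hm2]].
  - reflexivity.
  - reflexivity.
  - intros N. simpl partial_prod. rewrite coeff_mat_Mmult2 by lia.
    unfold coeff_mat; simpl. unfold D. simpl. ring.
  - intros N. simpl partial_prod. rewrite coeff_mat_Mmult2 by lia.
    unfold coeff_mat; simpl. unfold D. simpl. ring.
  - intros N. specialize (Hk0 N).
    assert (HD : D N <> 0).
    { apply Cmult_neq_0; [|apply Hl; lia]. apply Cmod_gt_0. rewrite Cmod_nat_to_C. lra. }
    rewrite !Cmod_div by auto.
    assert (HD' := proj1 (Cmod_gt_0 _) HD).
    replace (Cmod lambda / Cmod (D N) + Cmod (mu ^ 2) / Cmod (D N))%R
      with (L / Cmod (D N))%R by (unfold L; field; lra).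
    assert (E : Cmod (D N) = (INR (S k + N) * Cmod (nat_to_C (S k + N) + l))%R).
    { unfold D. now rewrite Cmod_mult, Cmod_nat_to_C. }
    specialize (HK (S k + N)%nat ltac:(lia)).
    unfold T, Q. replace (S k + S N)%nat with (S (S k + N)) by lia.
    rewrite S_INR. rewrite E in HD' |- *.
    set (j := INR (S k + N)) in *. set (c := Cmod (nat_to_C (S k + N) + l)) in *.
    assert (Hc : (0 < c)%R) by nra.
    replace (L * K0 / j - L * K0 / (j + 1))%R with (L * (K0 * / (j * (j + 1))))%R by (field; lra).
    apply Rmult_le_compat_l; auto.
    apply (Rmult_le_reg_r (j * c * (j + 1))); [apply Rmult_lt_0_compat; lra|].
    replace (/ (j * c) * (j * c * (j + 1)))%R with (j + 1)%R by (field; lra).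
    replace (K0 * / (j * (j + 1)) * (j * c * (j + 1)))%R with (K0 * c)%R by (field; lra).
    auto.
  - intros N. unfold T. apply Rmult_le_pos; auto.
    left. apply Rinv_0_lt_compat. generalize (Hk0 N). lra.
  - unfold T. apply (is_lim_seq_ext (fun N => Q * / INR (N + S k))%R).
    { intros N. unfold Rdiv. now rewrite Nat.add_comm. }
    apply (is_lim_seq_incr_n (fun N => Q * / INR N)%R (S k)).
    replace (Finite 0) with (Rbar_mult Q (Rbar_inv p_infty)) by (simpl; f_equal; ring).
    apply (is_lim_seq_scal_l (fun N => / INR N)%R Q).
    apply is_lim_seq_inv; [apply is_lim_seq_INR|discriminate].
  - assert (Em : minimal_sol l lambda mu k = m).
    { unfold minimal_sol, R_inf. rewrite coeff_mat_bij by lia.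
      now apply C_lim_seq_unique. }
    rewrite Em. split; auto.
    eapply Rle_trans; [exact Hm2|]. unfold T. rewrite Nat.add_0_r, S_INR.
    assert (H1 := pos_INR k). unfold Rdiv. rewrite <- Rmult_assoc.
    assert (H2 : (0 < / (INR k + 1))%R) by (apply Rinv_0_lt_compat; lra).
    apply Rmult_le_compat_r; [lra|]. apply Rmult_le_compat_r; auto.
    assert (Q * / (INR k + 1) <= Q)%R.
    { rewrite <- (Rmult_1_r Q) at 2. apply Rmult_le_compat_l; auto.
      rewrite <- Rinv_1. apply Rinv_le_contravar; lra. }
    destruct H as [H|H]; [left; now apply exp_increasing | rewrite H; lra].
Qed.

(** The second row of [M_1] is [(1, 0)], so the entry 21 of a product of [N + 1] factors is the
    entry 11 of the product of the last [N]. *)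
Lemma xi_minimal_sol (l lambda mu : C) :
  (forall k, (1 <= k)%nat -> nat_to_C k + l <> 0) ->
  xi l lambda mu = lambda * minimal_sol l lambda mu 0 + mu ^ 2 * minimal_sol l lambda mu 1.
Proof.
  intros Hl. destruct (partial_prod_limit l lambda mu Hl) as [K HK].
  unfold xi. f_equal. f_equal. unfold R_inf. rewrite coeff_mat_bij by lia.
  apply C_lim_seq_unique.
  destruct (HK 1%nat) as [H _].
  intros P HP. destruct (H P HP) as [N HN].
  exists (S N). intros [|n] Hn; [lia|].
  rewrite partial_prod_cons, coeff_mat_Mmult2 by lia.
  specialize (HN n ltac:(lia)).
  match goal with |- P ?x => match type of HN with P ?y => replace x with y; auto end end.
  unfold M at 1 2. unfold coeff_mat at 2 4; simpl. ring.
Qed.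

(** Two factors are peeled off on the left: the first row of [M_(k+1)] gives the coefficients, and
    the second row [(1, 0)] of [M_(k+2)] turns an entry 21 into an entry 11 one index later. The
    identity for finite products then passes to the limit. *)
Lemma minimal_sol_rec (l lambda mu : C) (k : nat) :
  (forall k, (1 <= k)%nat -> nat_to_C k + l <> 0) ->
  minimal_sol l lambda mu k =
  (1 + lambda / (nat_to_C (S k) * (nat_to_C (S k) + l))) * minimal_sol l lambda mu (S k)
  + mu ^ 2 / (nat_to_C (S k) * (nat_to_C (S k) + l)) * minimal_sol l lambda mu (S (S k)).
Proof.
  intros Hl. destruct (partial_prod_limit l lambda mu Hl) as [K HK].
  assert (H0 := proj1 (HK k)). assert (H1 := proj1 (HK (S k))). assert (H2 := proj1 (HK (S (S k)))).
  set (c1 := 1 + lambda / _). set (c2 := mu ^ 2 / _).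
  set (x0 := fun N => coeff_mat (RtoC 0) (partial_prod l lambda mu (S k) N) 0 0) in *.
  set (x1 := fun N => coeff_mat (RtoC 0) (partial_prod l lambda mu (S (S k)) N) 0 0) in *.
  set (x2 := fun N => coeff_mat (RtoC 0) (partial_prod l lambda mu (S (S (S k))) N) 0 0) in *.
  assert (E : forall N, x0 (S (S N)) = c1 * x1 (S N) + c2 * x2 N).
  { intros N. unfold x0. rewrite partial_prod_cons, coeff_mat_Mmult2 by lia.
    fold (x1 (S N)). f_equal.
    rewrite partial_prod_cons, coeff_mat_Mmult2 by lia. fold (x2 N).
    unfold coeff_mat at 1 2 3; simpl. unfold c2; simpl; ring. }
  apply (filterlim_locally_unique (K := C_AbsRing) (V := C_NormedModule) (F := eventually)
    (fun N => x0 (S (S N)))).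
  - intros P HP. destruct (H0 P HP) as [N HN]. exists N. intros n Hn. apply HN. lia.
  - apply (filterlim_ext (fun N => c1 * x1 (S N) + c2 * x2 N)); [intros; now rewrite E|].
    eapply (filterlim_comp_2 (G := locally (c1 * minimal_sol l lambda mu (S k)))
        (H := locally (c2 * minimal_sol l lambda mu (S (S k))))).
    3: apply (filterlim_plus (V := C_NormedModule)).
    + eapply filterlim_comp; [|apply (filterlim_scal_r (V := C_NormedModule) c1)].
      intros P HP. destruct (H1 P HP) as [N HN]. exists N. intros n Hn. apply HN. lia.
    + eapply filterlim_comp; [exact H2|apply (filterlim_scal_r (V := C_NormedModule) c2)].
Qed.

Lemma minimal_sol_bounded (l lambda mu : C) :
  (forall k, (1 <= k)%nat -> nat_to_C k + l <> 0) ->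
  exists G, (0 < G)%R /\ forall k, (Cmod (minimal_sol l lambda mu k) <= G)%R.
Proof.
  intros Hl. destruct (partial_prod_limit l lambda mu Hl) as [K HK].
  exists (1 + Rabs K)%R. split; [generalize (Rabs_pos K); lra|]. intros k.
  replace (minimal_sol l lambda mu k) with (1 + (minimal_sol l lambda mu k - 1)) by ring.
  eapply Rle_trans; [apply Cmod_triangle|]. rewrite Cmod_1.
  apply Rplus_le_compat_l. eapply Rle_trans; [apply HK|].
  assert (H0 := pos_INR k).
  apply (Rmult_le_reg_r (INR k + 1)); [lra|].
  replace (K / (INR k + 1) * (INR k + 1))%R with K by (field; lra).
  generalize (Rle_abs K) (Rabs_pos K). nra.
Qed.

(** * Power series solutions *)

(* The coefficient of [z^k] in the left-hand side of the equation for [E = sum a_k z^k],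
   where [l = n - 1]. *)
Definition coef_residual (l lambda mu : C) (a : nat -> C) (k : nat) : C :=
  mu * nat_to_C (S k) * a (S k) + (nat_to_C k * (nat_to_C k + l) + lambda) * a k
  - mu * (nat_to_C k + l) * coef_shift a k.

Lemma ode_series (n lambda mu : C) (a : nat -> C) (z : C) :
  entire_coef a ->
  Cseries (fun k => coef_residual (n - 1) lambda mu a k * z ^ k)
   (z ^ 2 * PSC (coef_deriv (coef_deriv a)) z
    + (n * z + mu * (1 - z ^ 2)) * PSC (coef_deriv a) z
    + (lambda - mu * n * z) * PSC a z).
Proof.
  intros H0. assert (H1 := entire_coef_deriv a H0). assert (H2 := entire_coef_deriv _ H1).
  assert (S0 := PSC_correct a z H0).
  assert (S0z := Cseries_shift _ _ _ S0).
  assert (S1 := PSC_correct _ z H1).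
  assert (S1z := Cseries_shift _ _ _ S1).
  assert (S1zz := Cseries_shift _ _ _ S1z).
  assert (S2 := Cseries_shift _ _ _ (Cseries_shift _ _ _ (PSC_correct _ z H2))).
  refine (Cseries_ext _ _ _ _ _ _
   (Cseries_plus _ _ _ _ S2
   (Cseries_plus _ _ _ _ (Cseries_scal n _ _ S1z)
   (Cseries_plus _ _ _ _ (Cseries_scal mu _ _ S1)
   (Cseries_plus _ _ _ _ (Cseries_scal (- mu) _ _ S1zz)
   (Cseries_plus _ _ _ _ (Cseries_scal lambda _ _ S0)
                         (Cseries_scal (- mu * n) _ _ S0z))))))).
  - intros [|[|k]]; unfold coef_residual, coef_deriv; simpl;
      rewrite ?nat_to_C_S; unfold nat_to_C; simpl INR; ring.
  - simpl. ring.
Qed.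

Lemma solution_PSC (n lambda mu : C) (a : nat -> C) :
  entire_coef a ->
  (solution n lambda mu (PSC a) <->
   forall z, z ^ 2 * PSC (coef_deriv (coef_deriv a)) z
    + (n * z + mu * (1 - z ^ 2)) * PSC (coef_deriv a) z
    + (lambda - mu * n * z) * PSC a z = 0).
Proof.
  intros H0. assert (H1 := entire_coef_deriv a H0).
  assert (D1 : forall z, C_derive (PSC a) z = PSC (coef_deriv a) z).
  { intros z. now apply is_C_derive_unique, is_derive_PSC. }
  assert (D2 : forall z, is_derive (C_derive (PSC a)) z (PSC (coef_deriv (coef_deriv a)) z)).
  { intros z. apply (is_derive_ext (PSC (coef_deriv a))); [intros; now rewrite D1|].
    now apply is_derive_PSC. }
  split.
  - intros H z. destruct (H z) as [_ [_ E]].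
    now rewrite (is_C_derive_unique _ _ _ (D2 z)), D1 in E.
  - intros E z. split; [|split].
    + exists (PSC (coef_deriv a) z). now apply is_derive_PSC.
    + eexists. apply D2.
    + now rewrite (is_C_derive_unique _ _ _ (D2 z)), D1.
Qed.

Lemma Cseries_bounded (a : nat -> C) (l : C) :
  Cseries a l -> exists M, forall k, (Cmod (a k) <= M)%R.
Proof.
  intros H.
  destruct (filterlim_bounded (K := C_AbsRing) (V := C_NormedModule) (sum_n a)
    (ex_intro _ l H)) as [M HM].
  exists (M + M)%R. intros [|k].
  - specialize (HM O). rewrite sum_O in HM.
    change (Cmod (a O) <= M)%R in HM. generalize (Cmod_ge_0 (a O)). lra.
  - assert (H0 := HM k). assert (H1 := HM (S k)). rewrite sum_Sn in H1.
    set (s := sum_n a k) in *.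
    change (Cmod s <= M)%R in H0. change (Cmod (s + a (S k)) <= M)%R in H1.
    replace (a (S k)) with ((s + a (S k)) + - s) by ring.
    eapply Rle_trans; [apply Cmod_triangle|]. rewrite Cmod_opp. lra.
Qed.

Lemma solution_PSC_iff (n lambda mu : C) (a : nat -> C) :
  entire_coef a ->
  (solution n lambda mu (PSC a) <-> forall k, coef_residual (n - 1) lambda mu a k = 0).
Proof.
  intros H0. rewrite solution_PSC by auto. split.
  - intros E.
    (* Convergence at [z = 1] bounds the residuals themselves, as the identity theorem requires. *)
    destruct (Cseries_bounded _ _ (ode_series n lambda mu a 1 H0)) as [M HM].
    apply (Cseries_unique0 _ M).
    { intros k. generalize (HM k). now rewrite Cpow_1_l, Cmult_1_r. } intros z _. rewrite <- (E z). now apply ode_series.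
  - intros E z. assert (S := ode_series n lambda mu a z H0).
    apply (Cseries_bound _ _ 0) in S.
    + apply Cmod_eq_0. generalize (Cmod_ge_0 (z ^ 2 * PSC (coef_deriv (coef_deriv a)) z
    + (n * z + mu * (1 - z ^ 2)) * PSC (coef_deriv a) z
    + (lambda - mu * n * z) * PSC a z)). lra.
    + intros k. rewrite E, Cmult_0_l, Cmod_0. lra.
Qed.

(** Since [mu (k+1) <> 0], each relation determines [a (k+1)] from its two predecessors. With the
    convention [a (-1) = 0] built into [coef_shift], [a 0] alone starts the recursion. *)
Lemma coef_residual_zero (l lambda mu : C) (a : nat -> C) :
  mu <> 0 -> (forall k, coef_residual l lambda mu a k = 0) -> a O = 0 -> forall k, a k = 0.
Proof.
  intros Hmu H H0.
  assert (Hs := nat_to_C_S_neq_0).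
  assert (Hstep : forall k, a k = 0 -> coef_shift a k = 0 -> a (S k) = 0).
  { intros k E1 E2. specialize (H k). unfold coef_residual in H. rewrite E1, E2 in H.
    replace (a (S k)) with (/ (mu * nat_to_C (S k)) *
      (mu * nat_to_C (S k) * a (S k) + (nat_to_C k * (nat_to_C k + l) + lambda) * 0
       - mu * (nat_to_C k + l) * 0)) by (field; auto).
    rewrite H. ring. }
  assert (forall k, a k = 0 /\ coef_shift a k = 0).
  { induction k as [|k [IH1 IH2]]; split; auto. }
  intros k. apply H1.
Qed.

(** * Necessity: the Casoratian argument *)

Lemma bounded_solution_xi (l lambda mu : C) (a : nat -> C) (B : R) :
  (forall k, (1 <= k)%nat -> nat_to_C k + l <> 0) -> mu <> 0 ->
  (forall k, (Cmod (a k) <= B)%R) ->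
  (forall k, coef_residual l lambda mu a k = 0) ->
  a O * xi l lambda mu = 0.
Proof.
  intros Hl Hmu HB Ha. rewrite xi_minimal_sol by auto.
  set (m := minimal_sol l lambda mu).
  assert (Hm : forall k, m k =
    (1 + lambda / (nat_to_C (S k) * (nat_to_C (S k) + l))) * m (S k)
    + mu ^ 2 / (nat_to_C (S k) * (nat_to_C (S k) + l)) * m (S (S k))).
  { intros k. now apply minimal_sol_rec. }
  assert (Hs := nat_to_C_S_neq_0).
  assert (HlS : forall k, nat_to_C (S k) + l <> 0) by (intros; apply Hl; lia).
  (* Up to normalisation, the Casoratian of [a] and the minimal solution: it satisfies a
     first-order recurrence with factors growing like [k], so it is unbounded unless it
     vanishes. *)
  set (V := fun k => a k * mu * m (S k) / nat_to_C (S k) - a (S k) * m k).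
  assert (HV : forall k, V k =
     - (mu * nat_to_C (S (S k)) / (nat_to_C (S k) * (nat_to_C (S k) + l))) * V (S k)).
  { intros k. specialize (Ha (S k)). unfold coef_residual in Ha. simpl coef_shift in Ha.
    (* The residual at [k + 1] is solved for its oldest coefficient; with [Hm] for [m k], this
       expresses [V k] through the indices [k + 1] and [k + 2]. *)
    assert (Ea : a k = (mu * nat_to_C (S (S k)) * a (S (S k)) +
      (nat_to_C (S k) * (nat_to_C (S k) + l) + lambda) * a (S k)) / (mu * (nat_to_C (S k) + l))).
    { replace (mu * nat_to_C (S (S k)) * a (S (S k)) +
      (nat_to_C (S k) * (nat_to_C (S k) + l) + lambda) * a (S k))
      with ((mu * nat_to_C (S (S k)) * a (S (S k)) +
      (nat_to_C (S k) * (nat_to_C (S k) + l) + lambda) * a (S k) -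
       mu * (nat_to_C (S k) + l) * a k) + mu * (nat_to_C (S k) + l) * a k) by ring.
      rewrite Ha. field. auto. }
    unfold V. rewrite (Hm k), Ea. field. auto. }
  destruct (minimal_sol_bounded l lambda mu Hl) as [G [HG Hmb]]. fold m in Hmb.
  assert (HB0 : (0 <= B)%R) by (generalize (Cmod_ge_0 (a O)) (HB O); lra).
  assert (HVb : forall k, (Cmod (V k) <= B * Cmod mu * G + B * G)%R).
  { intros k. unfold V.
    eapply Rle_trans; [apply Cmod_triangle|]. rewrite Cmod_opp. apply Rplus_le_compat.
    - rewrite Cmod_div, Cmod_nat_to_C, !Cmod_mult by auto.
      assert (H1 : (1 <= INR (S k))%R) by (rewrite S_INR; generalize (pos_INR k); lra).
      assert (H2 : (Cmod (a k) * Cmod mu * Cmod (m (S k)) <= B * Cmod mu * G)%R).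
      { apply Rmult_le_compat; auto using Cmod_ge_0.
        - apply Rmult_le_pos; apply Cmod_ge_0.
        - apply Rmult_le_compat_r; auto using Cmod_ge_0. }
      eapply Rle_trans; [|exact H2].
      set (X := (Cmod (a k) * Cmod mu * Cmod (m (S k)))%R).
      assert (0 <= X)%R by (unfold X; repeat apply Rmult_le_pos; apply Cmod_ge_0).
      apply (Rmult_le_reg_r (INR (S k))); [lra|].
      replace (X / INR (S k) * INR (S k))%R with X by (field; lra). nra.
    - rewrite Cmod_mult. apply Rmult_le_compat; auto using Cmod_ge_0. }
  set (W := (B * Cmod mu * G + B * G)%R) in *.
  assert (Hmu0 := proj1 (Cmod_gt_0 mu) Hmu).
  (* For [k >= N] one has [|k + 1 + l| >= 4 |mu|] and [(k+2) / (k+1) <= 2], so the factor in [HV]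
     has modulus at most 1/2. *)
  destruct (nfloor_ex (Cmod l + 4 * Cmod mu) ltac:(generalize (Cmod_ge_0 l); lra)) as [N HN].
  assert (Hdouble : forall k, (N <= k)%nat -> (2 * Cmod (V k) <= Cmod (V (S k)))%R).
  { intros k Hk. rewrite (HV k), Cmod_mult, Cmod_opp, Cmod_div by (apply Cmult_neq_0; auto).
    rewrite !Cmod_mult, !Cmod_nat_to_C.
    assert (H1 : (INR N <= INR k)%R) by now apply le_INR.
    assert (H2 : (INR (S k) <= Cmod (nat_to_C (S k) + l) + Cmod l)%R).
    { rewrite <- (Cmod_nat_to_C (S k)), <- (Cmod_opp l) at 1.
      eapply Rle_trans; [|apply Cmod_triangle]. apply Req_le. f_equal. ring. }
    rewrite (S_INR (S k)), S_INR in *.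
    assert (H3 := pos_INR k). set (c := Cmod (nat_to_C (S k) + l)) in *.
    assert (Hc : (4 * Cmod mu <= c)%R) by lra.
    set (j := INR k) in *.
    rewrite <- Rmult_assoc. rewrite <- (Rmult_1_l (Cmod (V (S k)))) at 2.
    apply Rmult_le_compat_r; [apply Cmod_ge_0|].
    apply (Rmult_le_reg_r ((j + 1) * c)); [apply Rmult_lt_0_compat; lra|].
    replace (2 * (Cmod mu * (j + 1 + 1) / ((j + 1) * c)) * ((j + 1) * c))%R
      with (2 * Cmod mu * (j + 1 + 1))%R by (field; lra).
    nra. }
  assert (HVN : V N = 0).
  { assert (Hp : forall p, (2 ^ p * Cmod (V N) <= W)%R).
    { intros p. apply Rle_trans with (Cmod (V (p + N)%nat)); [|apply HVb].
      induction p as [|p IH]; [simpl; lra|].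
      simpl. specialize (Hdouble (p + N)%nat ltac:(lia)). lra. }
    destruct (Ceq_dec (V N) 0) as [|Hne]; auto. exfalso.
    apply Cmod_gt_0 in Hne.
    assert (HW : (0 <= W / Cmod (V N))%R).
    { specialize (Hp O). simpl in Hp. apply Rmult_le_pos; [lra|]. left; now apply Rinv_0_lt_compat. }
    destruct (nfloor_ex (W / Cmod (V N)) HW) as [p Hp2].
    specialize (Hp (S p)). assert (H1 := INR_le_pow2 (S p)). rewrite S_INR in H1.
    assert (H2 : (W < 2 ^ S p * Cmod (V N))%R).
    { replace W with (W / Cmod (V N) * Cmod (V N))%R by (field; lra).
      apply Rmult_lt_compat_r; lra. }
    lra. }
  (* [HV] expresses [V k] as a multiple of [V (k+1)], so vanishing descends from [N] to 0. *)
  assert (HV0 : V O = 0).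
  { clear -HV HVN. induction N as [|N IH]; auto. apply IH. rewrite HV, HVN. ring. }
  (* The residual at 0 is [mu a_1 + lambda a_0]; adding [m_0] times it to [mu V_0] cancels [a_1] and
     leaves [a_0 xi]. *)
  assert (E0 := Ha O). unfold coef_residual in E0. simpl coef_shift in E0.
  unfold V in HV0. change (nat_to_C 0) with (RtoC 0) in E0.
  change (nat_to_C 1) with (RtoC 1) in E0, HV0.
  replace (a O * (lambda * m O + mu ^ 2 * m 1%nat)) with
    (mu * (a O * mu * m 1%nat / 1 - a 1%nat * m O)
     + m O * (mu * 1 * a 1%nat + (0 * (0 + l) + lambda) * a O - mu * (0 + l) * 0))
    by (field).
  rewrite HV0, E0. ring.
Qed.

(** * Sufficiency: the series built from the minimal solution *)

(** [mu^k / k!], in recursive form so that the ratio of neighbouring terms, which is what the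
    recurrence sees, appears by simplification. *)
Fixpoint exp_coef (mu : C) (k : nat) : C :=
  match k with O => RtoC 1 | S j => exp_coef mu j * mu / nat_to_C (S j) end.

Lemma Cmod_exp_coef (mu : C) (k : nat) :
  Cmod (exp_coef mu k) = (Cmod mu ^ k / INR (fact k))%R.
Proof.
  induction k as [|k IH].
  - simpl. rewrite Cmod_1. field.
  - assert (Hs := nat_to_C_S_neq_0 k).
    simpl exp_coef. rewrite Cmod_div, Cmod_mult, IH, Cmod_nat_to_C by auto.
    rewrite fact_simpl, mult_INR. simpl pow. field.
    split; [apply INR_fact_neq_0 | now apply not_0_INR].
Qed.

Lemma pow_fact_le_exp (x : R) (k : nat) : (0 <= x)%R -> (x ^ k / INR (fact k) <= exp x)%R.
Proof.
  intros Hx. eapply Rle_trans; [|apply (exp_ge_taylor x k Hx)].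
  assert (Hp : forall j, (0 <= x ^ j / INR (fact j))%R).
  { intros j. apply Rmult_le_pos; [now apply pow_le|]. left. apply Rinv_0_lt_compat, INR_fact_lt_0. }
  destruct k as [|k]; [simpl; lra|].
  rewrite tech5. generalize (cond_pos_sum _ k Hp). lra.
Qed.

Lemma entire_coef_minimal (l lambda mu : C) :
  (forall k, (1 <= k)%nat -> nat_to_C k + l <> 0) ->
  entire_coef (fun k => exp_coef mu k * minimal_sol l lambda mu k).
Proof.
  intros Hl r Hr. destruct (minimal_sol_bounded l lambda mu Hl) as [G [HG Hmb]].
  exists (exp (Cmod mu * r) * G)%R. intros k.
  rewrite Cmod_mult, Cmod_exp_coef.
  replace (Cmod mu ^ k / INR (fact k) * Cmod (minimal_sol l lambda mu k) * r ^ k)%R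
    with ((Cmod mu * r) ^ k / INR (fact k) * Cmod (minimal_sol l lambda mu k))%R
    by (rewrite Rpow_mult_distr; field; apply INR_fact_neq_0).
  assert (H0 : (0 <= Cmod mu * r)%R) by (apply Rmult_le_pos; [apply Cmod_ge_0 | lra]).
  apply Rmult_le_compat; auto using Cmod_ge_0, pow_fact_le_exp.
  apply Rmult_le_pos; [now apply pow_le|]. left. apply Rinv_0_lt_compat, INR_fact_lt_0.
Qed.

(** At [k = 0] the residual is exactly [xi]; at later indices it vanishes by the recurrence of the
    minimal solution. *)
Lemma coef_residual_minimal (l lambda mu : C) (k : nat) :
  (forall k, (1 <= k)%nat -> nat_to_C k + l <> 0) ->
  xi l lambda mu = 0 ->
  coef_residual l lambda mu (fun k => exp_coef mu k * minimal_sol l lambda mu k) k = 0.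
Proof.
  intros Hl Hxi. rewrite xi_minimal_sol in Hxi by auto.
  unfold coef_residual. destruct k as [|k].
  - simpl. etransitivity; [|exact Hxi]. change (nat_to_C 1) with (RtoC 1).
    change (nat_to_C 0) with (RtoC 0). field.
  - simpl coef_shift. rewrite (minimal_sol_rec l lambda mu k) by auto.
    assert (Hs := nat_to_C_S_neq_0).
    assert (HlS := Hl (S k) ltac:(lia)).
    simpl exp_coef. field. auto.
Qed.

Lemma minimal_sol_nonzero (l lambda mu : C) :
  (forall k, (1 <= k)%nat -> nat_to_C k + l <> 0) ->
  exists k, minimal_sol l lambda mu k <> 0.
Proof.
  intros Hl. destruct (partial_prod_limit l lambda mu Hl) as [K HK].
  (* [|K| < N + 1] makes the distance from [m_N] to 1 less than 1. *)
  destruct (nfloor_ex (Rabs K) (Rabs_pos K)) as [N HN]. exists N. intros E.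
  destruct (HK N) as [_ H]. rewrite E in H.
  replace (0 - 1) with (- (1)) in H by ring. rewrite Cmod_opp, Cmod_1 in H.
  assert (H0 := pos_INR N). assert (H1 := Rle_abs K).
  apply (Rmult_le_compat_r (INR N + 1)) in H; [|lra].
  replace (K / (INR N + 1) * (INR N + 1))%R with K in H by (field; lra). lra.
Qed.

Lemma PSC_0 (a : nat -> C) : PSC a 0 = a O.
Proof.
  apply PSC_unique.
  refine (Cseries_ext _ _ _ _ (fun k => eq_refl) _ (Cseries_head (fun k => a k * 0 ^ k) _)).
  - simpl. ring.
  - intros k. simpl. ring.
Qed.

(** * Cauchy's theorem and Taylor expansion of entire functions *)

Lemma im_le_Cmod (c : C) : (Rabs (Im c) <= Cmod c)%R.
Proof. eapply Rle_trans; [apply Rmax_r|apply Rmax_Cmod]. Qed.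

Lemma Cmod_le_re_im (c : C) : (Cmod c <= Rabs (Re c) + Rabs (Im c))%R.
Proof.
  replace c with (RtoC (Re c) + Ci * RtoC (Im c)) at 1.
  - eapply Rle_trans; [apply Cmod_triangle|].
    rewrite Cmod_mult, Cmod_Ci, !Cmod_R. lra.
  - destruct c as [x y]. unfold Ci, Cplus, Cmult, RtoC; simpl. f_equal; ring.
Qed.

Lemma Ceq_re_im (c d : C) : Re c = Re d -> Im c = Im d -> c = d.
Proof. destruct c, d; simpl; intros -> ->; reflexivity. Qed.

Lemma continuous_Re {U : UniformSpace} (f : U -> C) (x : U) :
  continuous (U := C_UniformSpace) f x -> continuous (fun y => Re (f y)) x.
Proof.
  intros H. apply (continuous_comp (V := C_UniformSpace) f Re); auto.
  destruct (f x) as [u v]. apply continuous_fst.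
Qed.

Lemma continuous_Im {U : UniformSpace} (f : U -> C) (x : U) :
  continuous (U := C_UniformSpace) f x -> continuous (fun y => Im (f y)) x.
Proof.
  intros H. apply (continuous_comp (V := C_UniformSpace) f Im); auto.
  destruct (f x) as [u v]. apply continuous_snd.
Qed.

Lemma continuous_re_im {U : UniformSpace} (f : U -> C) (x : U) :
  continuous (fun y => Re (f y)) x -> continuous (fun y => Im (f y)) x ->
  continuous (U := C_UniformSpace) f x.
Proof.
  intros H1 H2. apply filterlim_Cmod; [apply locally_filter|]. intros eps He.
  assert (He2 : (0 < eps / 2)%R) by lra.
  assert (A1 := H1 _ (locally_ball (Re (f x)) (mkposreal _ He2))).
  assert (A2 := H2 _ (locally_ball (Im (f x)) (mkposreal _ He2))).
  change (locally x (fun y => (Rabs (Re (f y) - Re (f x)) < eps / 2)%R)) in A1.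
  change (locally x (fun y => (Rabs (Im (f y) - Im (f x)) < eps / 2)%R)) in A2.
  generalize (filter_and _ _ A1 A2). apply filter_imp. intros y [E1 E2].
  eapply Rle_lt_trans; [apply Cmod_le_re_im|].
  change (Re (f y - f x)) with (Re (f y) - Re (f x))%R.
  change (Im (f y - f x)) with (Im (f y) - Im (f x))%R. lra.
Qed.

Lemma continuous_Cplus {U : UniformSpace} (f g : U -> C) (x : U) :
  continuous (U := C_UniformSpace) f x -> continuous (U := C_UniformSpace) g x ->
  continuous (U := C_UniformSpace) (fun y => f y + g y) x.
Proof. apply (continuous_plus (V := C_NormedModule)). Qed.

Lemma continuous_Cmult {U : UniformSpace} (f g : U -> C) (x : U) :
  continuous (U := C_UniformSpace) f x -> continuous (U := C_UniformSpace) g x ->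
  continuous (U := C_UniformSpace) (fun y => f y * g y) x.
Proof.
  intros Hf Hg. apply (continuous_scal (K := C_AbsRing) (V := C_NormedModule)); auto.
  intros P HP. apply Hf. now apply locally_C.
Qed.

Lemma continuous_Cinv {U : UniformSpace} (f : U -> C) (x : U) :
  continuous (U := C_UniformSpace) f x -> f x <> 0 ->
  continuous (U := C_UniformSpace) (fun y => / f y) x.
Proof.
  intros Hf Hx. assert (H0 := proj1 (Cmod_gt_0 _) Hx).
  set (c := Cmod (f x)) in *.
  apply filterlim_Cmod; [apply locally_filter|]. intros eps He.
  assert (Hf' := proj1 (filterlim_Cmod _ _ _) Hf).
  (* The first condition keeps [|f y| > c / 2]; the difference of the inverses is then below
     [2 |f y - f x| / c^2], which the second makes less than [eps]. *)
  assert (A1 := Hf' (c / 2)%R ltac:(lra)).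
  assert (A2 := Hf' (eps * c * (c / 2))%R ltac:(repeat apply Rmult_lt_0_compat; lra)).
  generalize (filter_and _ _ A1 A2). apply filter_imp. intros y [E1 E2].
  assert (E3 : (c / 2 < Cmod (f y))%R).
  { assert (Cmod (f x) <= Cmod (f y) + Cmod (f y - f x))%R.
    { rewrite <- (Cmod_opp (f y - f x)). eapply Rle_trans; [|apply Cmod_triangle].
      apply Req_le. f_equal. ring. }
    fold c in H. lra. }
  assert (Hy : f y <> 0) by (apply Cmod_gt_0; lra).
  replace (/ f y - / f x) with (- (f y - f x) / (f y * f x)) by (field; auto).
  rewrite Cmod_div, Cmod_opp, Cmod_mult by (apply Cmult_neq_0; auto). fold c.
  apply (Rmult_lt_reg_r (Cmod (f y) * c)); [apply Rmult_lt_0_compat; lra|].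
  replace (Cmod (f y - f x) / (Cmod (f y) * c) * (Cmod (f y) * c))%R
    with (Cmod (f y - f x)) by (field; lra).
  eapply Rlt_trans; [exact E2|].
  replace (eps * (Cmod (f y) * c))%R with (eps * c * Cmod (f y))%R by ring.
  apply Rmult_lt_compat_l; auto. now apply Rmult_lt_0_compat.
Qed.

(** * Derivatives of complex-valued functions of a real variable *)

(** Componentwise, so that the real theorems on integrals and on parameters apply to each part. *)
Definition path_derive (g : R -> C) (t : R) (v : C) : Prop :=
  is_derive (fun s => Re (g s)) t (Re v) /\ is_derive (fun s => Im (g s)) t (Im v).

Lemma path_derive_ext (f g : R -> C) (t : R) (v : C) :
  (forall s, f s = g s) -> path_derive f t v -> path_derive g t v.
Proof.
  intros H [H1 H2]. split; [revert H1 | revert H2]; apply is_derive_ext; intros s; now rewrite H.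
Qed.

Lemma path_derive_Cmod (g : R -> C) (t : R) (v : C) :
  path_derive g t v <->
  forall eps : R, (0 < eps)%R -> exists d : R, (0 < d)%R /\
    forall h : R, (Rabs h < d)%R ->
      (Cmod (g (t + h)%R - g t - RtoC h * v) <= eps * Rabs h)%R.
Proof.
  assert (Er : forall f l, is_derive f t l <->
    forall eps : R, (0 < eps)%R -> exists d : R, (0 < d)%R /\
    forall h : R, (Rabs h < d)%R -> (Rabs (f (t + h) - f t - h * l) <= eps * Rabs h)%R).
  { intros f l. split.
    - intros [_ H] eps He.
      destruct (H t (fun P HP => HP) (mkposreal eps He)) as [d Hd].
      exists d. split; [apply cond_pos|]. intros h Hh.
      specialize (Hd (t + h)%R).
      assert (Hb : Rabs (t + h - t) < d) by (now replace (t + h - t)%R with h by ring).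
      specialize (Hd Hb). clear Hb.
      unfold norm, minus, plus, opp, scal in Hd; simpl in Hd. unfold mult in Hd; simpl in Hd.
      unfold abs in Hd; simpl in Hd.
      now replace (t + h + - t)%R with h in Hd by ring.
    - intros H. split; [apply is_linear_scal_l|].
      intros x Hx. apply (is_filter_lim_locally_unique (V := R_NormedModule)) in Hx. subst x.
      intros [eps He]. destruct (H eps He) as [d [Hd Hh]]. exists (mkposreal d Hd).
      intros y Hy. specialize (Hh (y - t)%R Hy).
      unfold norm, minus, plus, opp, scal; simpl. unfold mult; simpl. unfold abs; simpl.
      rewrite (Rplus_minus t y) in Hh. exact Hh. }
  unfold path_derive. rewrite !Er. split.
  - intros [H1 H2] eps He.
    destruct (H1 (eps / 2)%R ltac:(lra)) as [d1 [Hd1 E1]].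
    destruct (H2 (eps / 2)%R ltac:(lra)) as [d2 [Hd2 E2]].
    exists (Rmin d1 d2). split; [now apply Rmin_pos|]. intros h Hh.
    specialize (E1 h (Rlt_le_trans _ _ _ Hh (Rmin_l _ _))).
    specialize (E2 h (Rlt_le_trans _ _ _ Hh (Rmin_r _ _))).
    eapply Rle_trans; [apply Cmod_le_re_im|].
    replace (Re (g (t + h)%R - g t - RtoC h * v)) with (Re (g (t + h)%R) - Re (g t) - h * Re v)%R
      by (unfold Re, Im; simpl; ring).
    replace (Im (g (t + h)%R - g t - RtoC h * v)) with (Im (g (t + h)%R) - Im (g t) - h * Im v)%R
      by (unfold Re, Im; simpl; ring).
    lra.
  - intros H. split; intros eps He; destruct (H eps He) as [d [Hd E]];
      exists d; (split; [auto|]); intros h Hh; specialize (E h Hh).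
    + eapply Rle_trans; [|exact E]. eapply Rle_trans; [|apply re_le_Cmod].
      apply Req_le. f_equal. unfold Re, Im; simpl; ring.
    + eapply Rle_trans; [|exact E]. eapply Rle_trans; [|apply im_le_Cmod].
      apply Req_le. f_equal. unfold Re, Im; simpl; ring.
Qed.

(** A chain rule across two scalar fields: [F] is complex differentiable, [g] is a real path. *)
Lemma path_derive_comp (F : C -> C) (g : R -> C) (t : R) (v l : C) :
  is_derive F (g t) l -> path_derive g t v -> path_derive (fun s => F (g s)) t (v * l).
Proof.
  intros HF Hg. apply path_derive_Cmod. intros eps He.
  assert (Hg' := proj1 (path_derive_Cmod _ _ _) Hg).
  assert (H0 := Cmod_ge_0 v). assert (H1 := Cmod_ge_0 l).
  assert (He1 : (0 < eps / 2 / (1 + Cmod v))%R) by (repeat apply Rdiv_lt_0_compat; lra).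
  destruct (proj1 (is_derive_Cmod _ _ _) HF _ He1) as [d1 [Hd1 E1]].
  assert (He2 : (0 < eps / 2 / (1 + Cmod l))%R) by (repeat apply Rdiv_lt_0_compat; lra).
  destruct (Hg' _ He2) as [d2 [Hd2 E2]].
  destruct (Hg' 1%R Rlt_0_1) as [d3 [Hd3 E3]].
  (* [d3] gives [|k| <= (1 + |v|) |h|] for the increment [k] of [g], and the last bound then keeps
     [k] within the range [d1] of [F]. *)
  exists (Rmin (Rmin d2 d3) (d1 / (1 + Cmod v))). split.
  { repeat apply Rmin_pos; auto. apply Rdiv_lt_0_compat; lra. }
  intros h Hh.
  assert (Hh1 := Rlt_le_trans _ _ _ Hh (Rmin_l _ _)).
  assert (Hh2 := Rlt_le_trans _ _ _ Hh1 (Rmin_l _ _)).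
  assert (Hh3 := Rlt_le_trans _ _ _ Hh1 (Rmin_r _ _)).
  assert (Hh4 := Rlt_le_trans _ _ _ Hh (Rmin_r _ _)).
  specialize (E2 h Hh2). specialize (E3 h Hh3).
  set (k := g (t + h)%R - g t) in *.
  assert (Hr := Rabs_pos h).
  assert (Hk : (Cmod k <= (1 + Cmod v) * Rabs h)%R).
  { replace k with ((k - RtoC h * v) + RtoC h * v) by ring.
    eapply Rle_trans; [apply Cmod_triangle|]. rewrite Cmod_mult, Cmod_R. lra. }
  assert (Hk1 : (Cmod k < d1)%R).
  { eapply Rle_lt_trans; [exact Hk|]. apply (Rmult_lt_compat_l (1 + Cmod v)) in Hh4; [|lra].
    now replace ((1 + Cmod v) * (d1 / (1 + Cmod v)))%R with d1 in Hh4 by (field; lra). }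
  specialize (E1 k Hk1). replace (g t + k) with (g (t + h)%R) in E1 by (unfold k; ring).
  replace (F (g (t + h)%R) - F (g t) - RtoC h * (v * l)) with
    ((F (g (t + h)%R) - F (g t) - k * l) + (k - RtoC h * v) * l) by ring.
  eapply Rle_trans; [apply Cmod_triangle|]. rewrite Cmod_mult.
  assert (X1 : (eps / 2 / (1 + Cmod v) * Cmod k <= eps / 2 * Rabs h)%R).
  { replace (eps / 2 * Rabs h)%R with (eps / 2 / (1 + Cmod v) * ((1 + Cmod v) * Rabs h))%R by (field; lra).
    apply Rmult_le_compat_l; lra. }
  assert (X2 : (Cmod (k - RtoC h * v) * Cmod l <= eps / 2 * Rabs h)%R).
  { replace (eps / 2 * Rabs h)%R with (eps / 2 / (1 + Cmod l) * Rabs h * (1 + Cmod l))%R by (field; lra).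
    apply Rmult_le_compat; auto using Cmod_ge_0. lra. }
  lra.
Qed.

Lemma path_derive_scal (c : C) (g : R -> C) (t : R) (v : C) :
  path_derive g t v -> path_derive (fun s => g s * c) t (v * c).
Proof.
  apply (path_derive_comp (fun z => z * c)).
  apply is_derive_Cmod. intros eps He. exists 1%R. split; [lra|]. intros h _.
  replace ((g t + h) * c - g t * c - h * c) with (RtoC 0) by ring.
  rewrite Cmod_0. generalize (Cmod_ge_0 h). nra.
Qed.

Lemma path_derive_affine (w c : C) (t : R) :
  path_derive (fun s => w + RtoC s * c) t c.
Proof.
  apply path_derive_Cmod. intros eps He. exists 1%R. split; [lra|]. intros h _.
  rewrite RtoC_plus.
  replace (w + (RtoC t + RtoC h) * c - (w + RtoC t * c) - RtoC h * c) with (RtoC 0) by ring.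
  rewrite Cmod_0. generalize (Rabs_pos h). nra.
Qed.

(** * Integrals over the circle *)

(** The integral is taken in the angle [t]; the factor of [dz = i z dt] is moved into the kernel. *)
Definition circle_int (f : R -> C) : C :=
  (RInt (fun t => Re (f t)) 0 (2 * PI), RInt (fun t => Im (f t)) 0 (2 * PI)).

Lemma ex_RInt_circle (f : R -> R) :
  (forall t, continuous f t) -> ex_RInt f 0 (2 * PI).
Proof. intros H. apply (ex_RInt_continuous (V := R_CompleteNormedModule)). auto. Qed.

Lemma circle_int_ext (f g : R -> C) : (forall t, f t = g t) -> circle_int f = circle_int g.
Proof.
  intros H. unfold circle_int. f_equal; apply RInt_ext; intros; now rewrite H.
Qed.

Lemma circle_int_plus (f g : R -> C) :
  (forall t, continuous (U := C_UniformSpace) f t) ->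
  (forall t, continuous (U := C_UniformSpace) g t) ->
  circle_int (fun t => f t + g t) = circle_int f + circle_int g.
Proof.
  intros Hf Hg. apply Ceq_re_im; simpl.
  - rewrite <- (RInt_plus (V := R_CompleteNormedModule)); auto;
      apply ex_RInt_circle; intros; now apply continuous_Re.
  - rewrite <- (RInt_plus (V := R_CompleteNormedModule)); auto;
      apply ex_RInt_circle; intros; now apply continuous_Im.
Qed.

Lemma circle_int_scal (c : C) (f : R -> C) :
  (forall t, continuous (U := C_UniformSpace) f t) ->
  circle_int (fun t => c * f t) = c * circle_int f.
Proof.
  intros Hf.
  assert (H1 : ex_RInt (fun t => Re (f t)) 0 (2 * PI)).
  { apply ex_RInt_circle; intros; now apply continuous_Re. }
  assert (H2 : ex_RInt (fun t => Im (f t)) 0 (2 * PI)).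
  { apply ex_RInt_circle; intros; now apply continuous_Im. }
  apply Ceq_re_im.
  - change (RInt (fun t => minus (scal (Re c) (Re (f t))) (scal (Im c) (Im (f t)))) 0 (2 * PI) =
      (Re c * RInt (fun t => Re (f t)) 0 (2 * PI) - Im c * RInt (fun t => Im (f t)) 0 (2 * PI))%R).
    rewrite (RInt_minus (V := R_CompleteNormedModule)), !(RInt_scal (V := R_CompleteNormedModule));
      auto; now apply (ex_RInt_scal (V := R_CompleteNormedModule)).
  - change (RInt (fun t => plus (scal (Re c) (Im (f t))) (scal (Im c) (Re (f t)))) 0 (2 * PI) =
      (Re c * RInt (fun t => Im (f t)) 0 (2 * PI) + Im c * RInt (fun t => Re (f t)) 0 (2 * PI))%R).
    rewrite (RInt_plus (V := R_CompleteNormedModule)), !(RInt_scal (V := R_CompleteNormedModule));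
      auto; now apply (ex_RInt_scal (V := R_CompleteNormedModule)).
Qed.

(** Real and imaginary parts are estimated separately, hence [4 PI] instead of [2 PI]. *)
Lemma circle_int_bound (f : R -> C) (B : R) :
  (forall t, continuous (U := C_UniformSpace) f t) ->
  (forall t, (0 <= t <= 2 * PI)%R -> (Cmod (f t) <= B)%R) ->
  (Cmod (circle_int f) <= 4 * PI * B)%R.
Proof.
  intros Hf HB. assert (Hpi := PI_RGT_0).
  eapply Rle_trans; [apply Cmod_le_re_im|]. simpl.
  assert (H1 : (Rabs (RInt (fun t => Re (f t)) 0 (2 * PI)) <= (2 * PI - 0) * B)%R).
  { apply abs_RInt_le_const; [lra| |].
    - apply ex_RInt_circle; intros; now apply continuous_Re.
    - intros t Ht. eapply Rle_trans; [apply re_le_Cmod|auto]. }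
  assert (H2 : (Rabs (RInt (fun t => Im (f t)) 0 (2 * PI)) <= (2 * PI - 0) * B)%R).
  { apply abs_RInt_le_const; [lra| |].
    - apply ex_RInt_circle; intros; now apply continuous_Im.
    - intros t Ht. eapply Rle_trans; [apply im_le_Cmod|auto]. }
  lra.
Qed.

Lemma circle_int_derive (g dg : R -> C) :
  (forall t, path_derive g t (dg t)) ->
  (forall t, continuous (U := C_UniformSpace) dg t) ->
  circle_int dg = g (2 * PI)%R - g 0%R.
Proof.
  intros Hg Hc. apply Ceq_re_im; simpl.
  - apply is_RInt_unique. apply (is_RInt_derive (V := R_CompleteNormedModule) (fun t => Re (g t))).
    + intros t _. apply Hg.
    + intros t _. now apply continuous_Re.
  - apply is_RInt_unique. apply (is_RInt_derive (V := R_CompleteNormedModule) (fun t => Im (g t))).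
    + intros t _. apply Hg.
    + intros t _. now apply continuous_Im.
Qed.

Lemma path_derive_circle_int (h dh : R -> R -> C) (t : R) :
  (forall s u, path_derive (fun s => h s u) s (dh s u)) ->
  (forall s u, continuous (T := prod_UniformSpace R_UniformSpace R_UniformSpace)
                 (U := C_UniformSpace) (fun p => dh (fst p) (snd p)) (s, u)) ->
  (forall s u, continuous (U := C_UniformSpace) (h s) u) ->
  path_derive (fun s => circle_int (h s)) t (circle_int (dh t)).
Proof.
  intros Hd Hc Hh. split; simpl.
  (* The integrand is put in the form in which [is_derive_RInt_param] states its conclusion. *)
  - rewrite (RInt_ext _ (fun u => Derive (fun s => Re (h s u)) t))
      by (intros; symmetry; apply is_derive_unique, Hd).
    apply (is_derive_RInt_param (fun s u => Re (h s u))).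
    + apply filter_forall. intros s u _. exists (Re (dh s u)). apply Hd.
    + intros u _. apply continuity_2d_pt_filterlim.
      apply (continuous_ext (fun p => Re (dh (fst p) (snd p)))).
      { intros p. symmetry. apply is_derive_unique, Hd. }
      apply (continuous_Re (fun p => dh (fst p) (snd p))), Hc.
    + apply filter_forall. intros s. apply ex_RInt_circle. intros. now apply continuous_Re.
  - rewrite (RInt_ext _ (fun u => Derive (fun s => Im (h s u)) t))
      by (intros; symmetry; apply is_derive_unique, Hd).
    apply (is_derive_RInt_param (fun s u => Im (h s u))).
    + apply filter_forall. intros s u _. exists (Im (dh s u)). apply Hd.
    + intros u _. apply continuity_2d_pt_filterlim.
      apply (continuous_ext (fun p => Im (dh (fst p) (snd p)))).
      { intros p. symmetry. apply is_derive_unique, Hd. }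
      apply (continuous_Im (fun p => dh (fst p) (snd p))), Hc.
    + apply filter_forall. intros s. apply ex_RInt_circle. intros. now apply continuous_Im.
Qed.

Lemma path_derive_zero (g : R -> C) (a b : R) :
  (a < b)%R -> (forall t, path_derive g t 0) -> g a = g b.
Proof.
  intros Hab H. apply Ceq_re_im.
  - apply (eq_is_derive (fun t => Re (g t))); auto. intros t _. apply H.
  - apply (eq_is_derive (fun t => Im (g t))); auto. intros t _. apply H.
Qed.

(** * The Cauchy kernel and contraction of the circle *)

Definition cis (t : R) : C := (cos t, sin t).

Definition cis_inv (t : R) : C := (cos t, - sin t)%R.

Lemma cis_mul_inv (t : R) : cis t * cis_inv t = 1.
Proof.
  unfold cis, cis_inv, Cmult, RtoC; simpl. f_equal; [|ring].
  generalize (sin2_cos2 t). unfold Rsqr. lra.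
Qed.

Lemma Cmod_cis_inv (t : R) : Cmod (cis_inv t) = 1%R.
Proof.
  transitivity (sqrt 1); [|apply sqrt_1]. apply (f_equal sqrt).
  rewrite <- (sin2_cos2 t). unfold Rsqr, cis_inv; simpl. ring.
Qed.

Lemma path_derive_cis (t : R) : path_derive cis t (Ci * cis t).
Proof.
  split; simpl.
  - replace (0 * cos t - 1 * sin t)%R with (- sin t)%R by ring. apply is_derive_cos.
  - replace (0 * sin t + 1 * cos t)%R with (cos t)%R by ring. apply is_derive_sin.
Qed.

Lemma path_derive_cis_inv (t : R) : path_derive cis_inv t (- Ci * cis_inv t).
Proof.
  split; simpl.
  - replace (- 0 * cos t - - (1) * - sin t)%R with (- sin t)%R by ring. apply is_derive_cos.
  - replace (- 0 * - sin t + - (1) * cos t)%R with (- cos t)%R by ring.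
    apply (is_derive_opp (K := R_AbsRing) (V := R_NormedModule)), is_derive_sin.
Qed.

Lemma path_derive_continuous (g : R -> C) (t : R) (v : C) :
  path_derive g t v -> continuous (U := C_UniformSpace) g t.
Proof.
  intros [H1 H2]. apply continuous_re_im.
  - apply (ex_derive_continuous (V := R_NormedModule)). now exists (Re v).
  - apply (ex_derive_continuous (V := R_NormedModule)). now exists (Im v).
Qed.

Lemma continuous_cis (t : R) : continuous (U := C_UniformSpace) cis t.
Proof. eapply path_derive_continuous, path_derive_cis. Qed.

Lemma continuous_cis_inv (t : R) : continuous (U := C_UniformSpace) cis_inv t.
Proof. eapply path_derive_continuous, path_derive_cis_inv. Qed.

(* [cis t / (cis t - w)], the Cauchy kernel with respect to [dt = dz / (i z)]. *)
Definition cauchy_kernel (w : C) (t : R) : C := / (1 - w * cis_inv t).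

Lemma cauchy_kernel_denom (w : C) (t : R) : (Cmod w < 1)%R -> 1 - w * cis_inv t <> 0.
Proof.
  intros Hw E. assert (H : Cmod (w * cis_inv t) = 1%R).
  { replace (w * cis_inv t) with (1 - (1 - w * cis_inv t)) by ring. rewrite E.
    replace (1 - 0) with (RtoC 1) by ring. apply Cmod_1. }
  rewrite Cmod_mult, Cmod_cis_inv in H. lra.
Qed.

Lemma continuous_cauchy_kernel (w : C) (t : R) :
  (Cmod w < 1)%R -> continuous (U := C_UniformSpace) (cauchy_kernel w) t.
Proof.
  intros Hw. apply (continuous_Cinv (fun t => 1 - w * cis_inv t)).
  2: now apply cauchy_kernel_denom.
  apply (continuous_Cplus (fun _ => RtoC 1)); [apply continuous_const|].
  apply (continuous_ext (fun t => (- w) * cis_inv t)).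
  { intros u. change ((- w) * cis_inv u = - (w * cis_inv u)). ring. }
  apply continuous_Cmult; [apply continuous_const | apply continuous_cis_inv].
Qed.

Lemma is_derive_affine (p q z : C) : is_derive (fun z => p + z * q) z q.
Proof.
  apply is_derive_Cmod. intros eps He. exists 1%R. split; [lra|]. intros h _.
  replace (p + (z + h) * q - (p + z * q) - h * q) with (RtoC 0) by ring.
  rewrite Cmod_0. generalize (Cmod_ge_0 h). nra.
Qed.

Lemma cis_2PI : cis (2 * PI) = cis 0.
Proof. unfold cis. now rewrite cos_2PI, sin_2PI, cos_0, sin_0. Qed.

Lemma cis_inv_2PI : cis_inv (2 * PI) = cis_inv 0.
Proof. unfold cis_inv. now rewrite cos_2PI, sin_2PI, cos_0, sin_0. Qed.

(* Contract the circle to [w] along segments: the [s]-derivative of the integral of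
   [F (w + s (cis u - w)) * kernel] is the integral of a [u]-derivative, divided by [i s]. *)
Lemma circle_int_homotopy (F G : C -> C) (w : C) :
  (forall z, is_derive F z (G z)) -> (forall z, continuous G z) -> (Cmod w < 1)%R ->
  circle_int (fun u => F (cis u) * cauchy_kernel w u)
  = F w * circle_int (cauchy_kernel w).
Proof.
  intros HF HG Hw.
  assert (HFc : forall z, continuous F z) by (intros z; eapply is_derive_continuous_C, HF).
  set (g := fun s u => w + RtoC s * (cis u - w)).
  set (h := fun s u => F (g s u) * cauchy_kernel w u).
  (* This is the [s]-derivative of [h]: the inner factor [cis u - w] times the kernel is [cis u]. *)
  set (dh := fun s u => G (g s u) * cis u).
  assert (Hgu : forall s u, path_derive (g s) u (Ci * cis u * RtoC s)).
  { intros s u.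
    refine (path_derive_ext _ _ _ _ _ (path_derive_comp _ _ _ _ _
      (is_derive_affine (w - RtoC s * w) (RtoC s) (cis u)) (path_derive_cis u))).
    intros t. change (w - RtoC s * w + cis t * RtoC s = w + RtoC s * (cis t - w)). ring. }
  assert (Hgc : forall s u, continuous (U := C_UniformSpace) (g s) u).
  { intros s u. eapply path_derive_continuous, Hgu. }
  assert (Hdhc : forall s u, continuous (U := C_UniformSpace) (dh s) u).
  { intros s u. apply (continuous_Cmult (fun u => G (g s u))); [|apply continuous_cis].
    apply (continuous_comp (V := C_UniformSpace) (g s) G); auto. }
  assert (Hdh0 : forall s, circle_int (dh s) = 0).
  { intros s. destruct (Req_dec s 0) as [->|Hs].
    (* At [s = 0] dividing by [i s] is impossible, but the integrand is a constant multiple of the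
       derivative of [cis]. *)
    - assert (E : circle_int (dh 0%R) = circle_int (fun u => G w * / Ci * (Ci * cis u))).
      { apply circle_int_ext. intros u. unfold dh, g.
        replace (w + RtoC 0 * (cis u - w)) with w by ring. field. apply Ci_nz. }
      rewrite E, circle_int_scal.
      + rewrite (circle_int_derive cis).
        * rewrite cis_2PI. ring.
        * apply path_derive_cis.
        * intros t. apply continuous_Cmult; [apply continuous_const|apply continuous_cis].
      + intros t. apply continuous_Cmult; [apply continuous_const|apply continuous_cis].
    - assert (Hs' : RtoC s <> 0) by (intros E; apply Hs, RtoC_inj, E).
      (* The integrand is the [u]-derivative of [F (g s u)], which is periodic in [u]. *)
      assert (E : circle_int (fun u => Ci * RtoC s * dh s u) = 0).
      { rewrite (circle_int_derive (fun u => F (g s u))).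
        - unfold g. rewrite cis_2PI. ring.
        - intros t. replace (Ci * RtoC s * dh s t) with (Ci * cis t * RtoC s * G (g s t))
            by (unfold dh; ring).
          now apply path_derive_comp.
        - intros t. apply continuous_Cmult; [apply continuous_const|auto]. }
      rewrite circle_int_scal in E by auto.
      replace (circle_int (dh s)) with (/ (Ci * RtoC s) * (Ci * RtoC s * circle_int (dh s))).
      + rewrite E. ring.
      + field. split; auto. apply Ci_nz. }
  assert (Hpath : forall s, path_derive (fun s => circle_int (h s)) s 0).
  { intros s. rewrite <- (Hdh0 s). apply path_derive_circle_int.
    - intros r u.
      replace (dh r u) with ((cis u - w) * G (g r u) * cauchy_kernel w u).
      + apply path_derive_scal. apply (path_derive_comp F (fun s => g s u)); [apply HF|].
        apply path_derive_affine.
      + unfold dh, cauchy_kernel.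
        replace (cis u - w) with (cis u * (1 - w * cis_inv u)).
        * field. now apply cauchy_kernel_denom.
        * replace (cis u * (1 - w * cis_inv u)) with (cis u - w * (cis u * cis_inv u)) by ring.
          rewrite cis_mul_inv. ring.
    - intros r u.
      assert (Hs : continuous (T := prod_UniformSpace R_UniformSpace R_UniformSpace)
         (U := C_UniformSpace) (fun p => cis (snd p)) (r, u)).
      { apply (continuous_comp (V := R_UniformSpace) snd cis); [apply continuous_snd | apply continuous_cis]. }
      apply (continuous_Cmult (fun p => G (g (fst p) (snd p)))); auto.
      apply (continuous_comp (V := C_UniformSpace) (fun p => g (fst p) (snd p)) G); auto.
      apply continuous_Cplus; [apply continuous_const|].
      apply (continuous_Cmult (fun p => RtoC (fst p)) (fun p => cis (snd p) - w)).
      + apply (continuous_re_im (fun p => RtoC (fst p))); simpl;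
          [apply continuous_fst | apply continuous_const].
      + apply (continuous_Cplus (fun p => cis (snd p))); auto. apply continuous_const.
    - intros r u. apply (continuous_Cmult (fun u => F (g r u))).
      + apply (continuous_comp (V := C_UniformSpace) (g r) F); auto.
      + now apply continuous_cauchy_kernel. }
  (* At [s = 1] the path is the unit circle, at [s = 0] it is the constant [w]. *)
  assert (E := path_derive_zero (fun s => circle_int (h s)) 0 1 Rlt_0_1 Hpath). simpl in E.
  rewrite <- circle_int_scal by (intros; now apply continuous_cauchy_kernel).
  transitivity (circle_int (h 1%R)); [|rewrite <- E]; apply circle_int_ext; intros t; unfold h, g.
  - replace (w + RtoC 1 * (cis t - w)) with (cis t) by ring. reflexivity.
  - replace (w + RtoC 0 * (cis t - w)) with w by ring. reflexivity.
Qed.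

Lemma circle_bounded (f : R -> C) :
  (forall t, continuous (U := C_UniformSpace) f t) ->
  exists B, (0 <= B)%R /\ forall t, (0 <= t <= 2 * PI)%R -> (Cmod (f t) <= B)%R.
Proof.
  intros Hf.
  destruct (bounded_continuity (K := C_AbsRing) (V := C_NormedModule) f 0 (2 * PI)) as [B HB].
  { intros t _. apply Hf. }
  assert (Hpi := PI_RGT_0).
  exists B. split.
  - left. apply Rle_lt_trans with (Cmod (f 0%R)); [apply Cmod_ge_0|]. apply HB. lra.
  - intros t Ht. left. now apply HB.
Qed.

Lemma continuous_Cpow {U : UniformSpace} (f : U -> C) (k : nat) (x : U) :
  continuous (U := C_UniformSpace) f x ->
  continuous (U := C_UniformSpace) (fun y => f y ^ k) x.
Proof.
  intros Hf. induction k as [|k IH]; simpl; [apply continuous_const|].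
  now apply continuous_Cmult.
Qed.

(** Iterating [1 / (1 - q) = 1 + q / (1 - q)] under the integral gives partial sums with the exact
    remainder [w^(k+1) r (k+1)]. As [r] is bounded, no interchange of sum and integral arises. *)
Lemma cauchy_kernel_series (f : R -> C) (w : C) :
  (forall t, continuous (U := C_UniformSpace) f t) -> (Cmod w < 1)%R ->
  Cseries (fun k => circle_int (fun t => f t * cis_inv t ^ k) * w ^ k)
          (circle_int (fun t => f t * cauchy_kernel w t)).
Proof.
  intros Hf Hw.
  set (I := circle_int (fun t => f t * cauchy_kernel w t)).
  set (r := fun k => circle_int (fun t => f t * cis_inv t ^ k * cauchy_kernel w t)).
  assert (Hfk : forall k t, continuous (U := C_UniformSpace) (fun t => f t * cis_inv t ^ k) t).
  { intros k t. apply continuous_Cmult; auto. apply continuous_Cpow, continuous_cis_inv. }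
  assert (Hfkk : forall k t, continuous (U := C_UniformSpace)
     (fun t => f t * cis_inv t ^ k * cauchy_kernel w t) t).
  { intros k t. apply (continuous_Cmult (fun t => f t * cis_inv t ^ k)); auto.
    now apply continuous_cauchy_kernel. }
  assert (Hstep : forall k, r k = circle_int (fun t => f t * cis_inv t ^ k) + w * r (S k)).
  { intros k. unfold r. rewrite <- circle_int_scal, <- circle_int_plus; auto.
    - apply circle_int_ext. intros t. simpl. unfold cauchy_kernel. field.
      now apply cauchy_kernel_denom.
    - intros t. apply continuous_Cmult; auto. apply continuous_const. }
  assert (Hsum : forall k,
    sum_n (fun k => circle_int (fun t => f t * cis_inv t ^ k) * w ^ k) k = I - w ^ S k * r (S k)).
  { induction k as [|k IH].
    - rewrite sum_O. assert (E : I = r O) by (apply circle_int_ext; intros; simpl; ring).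
      rewrite E, Hstep. simpl. ring.
    - rewrite sum_Sn, IH. change plus with Cplus. rewrite (Hstep (S k)). simpl. ring. }
  destruct (circle_bounded (fun t => f t * cauchy_kernel w t)) as [B [HB0 HB]].
  { intros t. apply continuous_Cmult; auto. now apply continuous_cauchy_kernel. }
  assert (Hpi := PI_RGT_0).
  assert (Hr : forall k, (Cmod (r k) <= 4 * PI * B)%R).
  { intros k. apply circle_int_bound; auto. intros t Ht.
    replace (f t * cis_inv t ^ k * cauchy_kernel w t) with (cis_inv t ^ k * (f t * cauchy_kernel w t)) by ring.
    rewrite Cmod_mult, Cmod_pow, Cmod_cis_inv, pow1, Rmult_1_l. auto. }
  apply filterlim_Cmod; [apply eventually_filter|]. intros eps He.
  assert (HQ : (0 <= 4 * PI * B)%R) by (apply Rmult_le_pos; lra).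
  assert (Hlim := is_lim_seq_geom (Cmod w) ltac:(rewrite Rabs_pos_eq; [lra|apply Cmod_ge_0])).
  apply is_lim_seq_spec in Hlim.
  assert (He' : (0 < eps / (4 * PI * B + 1))%R) by (apply Rdiv_lt_0_compat; lra).
  destruct (Hlim (mkposreal _ He')) as [N HN]. exists N. intros n Hn.
  specialize (HN (S n) ltac:(lia)). simpl pos in HN.
  assert (Hp : (0 <= Cmod w ^ S n)%R) by (apply pow_le, Cmod_ge_0).
  rewrite Rminus_0_r, Rabs_pos_eq in HN by auto.
  rewrite Hsum. replace (I - w ^ S n * r (S n) - I) with (- (w ^ S n * r (S n))) by ring.
  rewrite Cmod_opp, Cmod_mult, Cmod_pow.
  apply (Rmult_lt_compat_r (4 * PI * B + 1)) in HN; [|lra].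
  replace (eps / (4 * PI * B + 1) * (4 * PI * B + 1))%R with eps in HN by (field; lra).
  eapply Rle_lt_trans; [|exact HN]. apply Rmult_le_compat_l; auto.
  specialize (Hr (S n)). lra.
Qed.

Lemma is_derive_Cpow (k : nat) (z : C) :
  is_derive (fun z => z ^ k) z (nat_to_C k * z ^ pred k).
Proof.
  apply is_derive_Cmod. intros eps He.
  set (Q := ((2 * (1 + Cmod z)) ^ k)%R).
  assert (HQ : (0 < Q)%R) by (apply pow_lt; generalize (Cmod_ge_0 z); lra).
  exists (Rmin 1 (eps / Q)). split.
  { apply Rmin_pos; [lra|now apply Rdiv_lt_0_compat]. }
  intros h Hh.
  assert (Hh1 := Rlt_le_trans _ _ _ Hh (Rmin_l _ _)).
  assert (Hh2 := Rlt_le_trans _ _ _ Hh (Rmin_r _ _)).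
  eapply Rle_trans; [apply pow_taylor2; lra|]. fold Q.
  assert (H0 := Cmod_ge_0 h).
  apply (Rmult_lt_compat_r Q) in Hh2; auto.
  replace (eps / Q * Q)%R with eps in Hh2 by (field; lra). nra.
Qed.

(** Up to the nonzero factor [- i (k+1)], the integrand is the derivative of itself, a periodic
    function. *)
Lemma circle_int_cis_inv_pow (k : nat) : circle_int (fun t => cis_inv t ^ S k) = 0.
Proof.
  assert (Hc : forall t, continuous (U := C_UniformSpace) (fun t => cis_inv t ^ S k) t).
  { intros t. apply continuous_Cpow, continuous_cis_inv. }
  assert (Hs := nat_to_C_S_neq_0 k).
  assert (E : circle_int (fun t => - Ci * nat_to_C (S k) * cis_inv t ^ S k) = 0).
  { rewrite (circle_int_derive (fun t => cis_inv t ^ S k)).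
    - rewrite cis_inv_2PI. ring.
    - intros t. replace (- Ci * nat_to_C (S k) * cis_inv t ^ S k)
        with (- Ci * cis_inv t * (nat_to_C (S k) * cis_inv t ^ pred (S k))) by (simpl; ring).
      apply (path_derive_comp (fun z => z ^ S k)); [apply is_derive_Cpow | apply path_derive_cis_inv].
    - intros t. apply continuous_Cmult; auto. apply continuous_const. }
  rewrite circle_int_scal in E by auto.
  set (J := circle_int _) in *.
  replace J with (/ (Ci * nat_to_C (S k)) * - (- Ci * nat_to_C (S k) * J)).
  - rewrite E. ring.
  - field. split; auto. apply Ci_nz.
Qed.

Lemma circle_int_1 : circle_int (fun _ => RtoC 1) = RtoC (2 * PI).
Proof.
  apply Ceq_re_im.
  - change (RInt (fun _ => 1%R) 0 (2 * PI) = 2 * PI)%R.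
    rewrite RInt_const. change ((2 * PI - 0) * 1 = 2 * PI)%R. ring.
  - change (RInt (fun _ => 0%R) 0 (2 * PI) = 0)%R.
    rewrite RInt_const. change ((2 * PI - 0) * 0 = 0)%R. ring.
Qed.

(** In the kernel expansion for the constant function 1, only the term [k = 0] survives. *)
Lemma circle_int_cauchy_kernel (w : C) :
  (Cmod w < 1)%R -> circle_int (cauchy_kernel w) = RtoC (2 * PI).
Proof.
  intros Hw.
  assert (H1 := cauchy_kernel_series (fun _ => RtoC 1) w (fun t => continuous_const _ t) Hw).
  assert (H2 := Cseries_head (fun k => circle_int (fun t => 1 * cis_inv t ^ k) * w ^ k)).
  apply (filterlim_locally_unique (K := C_AbsRing) (V := C_NormedModule) (F := eventually) _) with
    (1 := (Cseries_ext _ _ _ (circle_int (cauchy_kernel w)) (fun k => eq_refl)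
           (circle_int_ext _ _ (fun t => Cmult_1_l _)) H1)).
  refine (Cseries_ext _ _ _ _ (fun k => eq_refl) _ (H2 _)).
  - rewrite <- circle_int_1. simpl. rewrite Cmult_1_r.
    apply circle_int_ext. intros t. ring.
  - intros k. rewrite (circle_int_ext _ (fun t => cis_inv t ^ S k)) by (intros; apply Cmult_1_l).
    rewrite circle_int_cis_inv_pow. ring.
Qed.

(** * Taylor expansion on discs and on the plane *)

(** The coefficients are Cauchy's integrals over the unit circle. Contraction evaluates the integral
    of [F] against the kernel as [2 PI F(z)], and the kernel expansion turns it into a series. *)
Lemma power_series_unit_disc (F G : C -> C) :
  (forall z, is_derive F z (G z)) -> (forall z, continuous G z) ->
  exists (a : nat -> C) (M : R), (forall k, (Cmod (a k) <= M)%R) /\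
    forall z, (Cmod z < 1)%R -> Cseries (fun k => a k * z ^ k) (F z).
Proof.
  intros HF HG. assert (Hpi := PI_RGT_0).
  assert (Hpi' : RtoC (2 * PI) <> 0) by (apply Cmod_gt_0; rewrite Cmod_R, Rabs_pos_eq; lra).
  assert (Hc : forall t, continuous (U := C_UniformSpace) (fun t => F (cis t)) t).
  { intros t. apply (continuous_comp (V := C_UniformSpace) cis F); [apply continuous_cis|].
    eapply is_derive_continuous_C, HF. }
  assert (Hck : forall k t, continuous (U := C_UniformSpace) (fun t => F (cis t) * cis_inv t ^ k) t).
  { intros k t. apply continuous_Cmult; auto. apply continuous_Cpow, continuous_cis_inv. }
  destruct (circle_bounded _ Hc) as [B [HB0 HB]].
  exists (fun k => / RtoC (2 * PI) * circle_int (fun t => F (cis t) * cis_inv t ^ k)).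
  exists (/ (2 * PI) * (4 * PI * B))%R. split.
  - intros k. rewrite Cmod_mult, Cmod_inv, Cmod_R, Rabs_pos_eq by (auto; lra).
    apply Rmult_le_compat_l; [left; apply Rinv_0_lt_compat; lra|].
    apply circle_int_bound; auto. intros t Ht.
    rewrite Cmod_mult, Cmod_pow, Cmod_cis_inv, pow1, Rmult_1_r. auto.
  - intros z Hz.
    assert (S := cauchy_kernel_series _ z Hc Hz).
    cbv beta in S. rewrite (circle_int_homotopy F G z HF HG Hz), circle_int_cauchy_kernel in S by auto.
    refine (Cseries_ext _ _ _ _ _ _ (Cseries_scal (/ RtoC (2 * PI)) _ _ S)).
    + intros k. ring.
    + field. auto.
Qed.

(** The unit disc case applied to [z -> F (r z)], whose coefficients are divided by [r^k]. *)
Lemma power_series_disc (F G : C -> C) (r : R) :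
  (forall z, is_derive F z (G z)) -> (forall z, continuous G z) -> (1 <= r)%R ->
  exists (a : nat -> C) (M : R), (forall k, (Cmod (a k) * r ^ k <= M)%R) /\
    forall z, (Cmod z < r)%R -> Cseries (fun k => a k * z ^ k) (F z).
Proof.
  intros HF HG Hr.
  assert (Hr0 : RtoC r <> 0) by (apply Cmod_gt_0; rewrite Cmod_R, Rabs_pos_eq; lra).
  destruct (power_series_unit_disc (fun z => F (z * RtoC r)) (fun z => RtoC r * G (z * RtoC r)))
    as [a [M [HM Ha]]].
  - intros z. apply is_derive_Cmod. intros eps He.
    destruct (proj1 (is_derive_Cmod _ _ _) (HF (z * RtoC r)) (eps / r)%R) as [d [Hd E]].
    { apply Rdiv_lt_0_compat; lra. }
    exists (d / r)%R. split; [apply Rdiv_lt_0_compat; lra|]. intros h Hh.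
    assert (Hhr : Cmod (h * RtoC r) = (Cmod h * r)%R).
    { rewrite Cmod_mult, Cmod_R, Rabs_pos_eq; lra. }
    specialize (E (h * RtoC r)). rewrite Hhr in E.
    replace ((z + h) * RtoC r) with (z * RtoC r + h * RtoC r) by ring.
    replace (h * (RtoC r * G (z * RtoC r))) with (h * RtoC r * G (z * RtoC r)) by ring.
    replace (eps * Cmod h)%R with (eps / r * (Cmod h * r))%R by (field; lra).
    apply E. apply (Rmult_lt_compat_r r) in Hh; [|lra].
    now replace (d / r * r)%R with d in Hh by (field; lra).
  - intros z. apply (continuous_Cmult (fun _ => RtoC r)); [apply continuous_const|].
    apply (continuous_comp (V := C_UniformSpace) (fun z => z * RtoC r) G); auto.
    apply (continuous_Cmult (fun z => z)); [apply continuous_id | apply continuous_const].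
  - exists (fun k => a k * (/ RtoC r) ^ k), M. split.
    + intros k. rewrite Cmod_mult, Cmod_pow, Cmod_inv, Cmod_R, Rabs_pos_eq by (auto; lra).
      rewrite Rmult_assoc, <- Rpow_mult_distr, Rinv_l, pow1, Rmult_1_r by lra. auto.
    + intros z Hz.
      assert (Hz' : (Cmod (z * / RtoC r) < 1)%R).
      { rewrite Cmod_mult, Cmod_inv, Cmod_R, Rabs_pos_eq by (auto; lra).
        apply (Rmult_lt_reg_r r); [lra|]. rewrite Rmult_assoc, Rinv_l by lra. lra. }
      refine (Cseries_ext _ _ _ _ _ _ (Ha _ Hz')).
      * intros k. rewrite Cpow_mult_l. ring.
      * cbv beta. f_equal. field. auto.
Qed.

Lemma Cseries_unique (a b : nat -> C) (f : C -> C) (A B : R) :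
  (forall k, (Cmod (a k) <= A)%R) -> (forall k, (Cmod (b k) <= B)%R) ->
  (forall z, (Cmod z < 1)%R -> Cseries (fun k => a k * z ^ k) (f z)) ->
  (forall z, (Cmod z < 1)%R -> Cseries (fun k => b k * z ^ k) (f z)) ->
  forall k, a k = b k.
Proof.
  intros HA HB Ha Hb k. apply Ceq_minus.
  apply (Cseries_unique0 (fun k => a k - b k) (A + B)).
  - intros j. eapply Rle_trans; [apply Cmod_triangle|]. rewrite Cmod_opp.
    generalize (HA j) (HB j). lra.
  - intros z Hz.
    refine (Cseries_ext _ _ _ _ _ _ (Cseries_plus _ _ _ _ (Ha z ltac:(lra))
      (Cseries_scal (- (1)) _ _ (Hb z ltac:(lra))))).
    + intros j. simpl. ring.
    + ring.
Qed.

(** Each radius yields its own coefficients, but on the unit disc all these expansions represent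
    [F]. By uniqueness they agree with those of radius 1, which thus satisfy the estimates at every
    radius. *)
Lemma entire_power_series (F G : C -> C) :
  (forall z, is_derive F z (G z)) -> (forall z, continuous G z) ->
  exists a, entire_coef a /\ forall z, PSC a z = F z.
Proof.
  intros HF HG.
  destruct (power_series_disc F G 1 HF HG (Rle_refl 1)) as [a [A [HA Ha]]].
  assert (HA' : forall k, (Cmod (a k) <= A)%R).
  { intros k. generalize (HA k). rewrite pow1. lra. }
  assert (H : forall r, (1 <= r)%R -> exists M, (forall k, (Cmod (a k) * r ^ k <= M)%R) /\
    forall z, (Cmod z < r)%R -> Cseries (fun k => a k * z ^ k) (F z)).
  { intros r Hr. destruct (power_series_disc F G r HF HG Hr) as [b [B [HB Hb]]].
    assert (E : forall k, b k = a k).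
    { apply (Cseries_unique b a F B A); auto.
      - intros k. eapply Rle_trans; [|apply (HB k)].
        rewrite <- (Rmult_1_r (Cmod (b k))) at 1.
        apply Rmult_le_compat_l; [apply Cmod_ge_0 | now apply pow_R1_Rle].
      - intros z Hz. apply Hb. lra. }
    exists B. split.
    - intros k. rewrite <- E. auto.
    - intros z Hz. refine (Cseries_ext _ _ _ _ _ eq_refl (Hb z Hz)).
      intros k. simpl. now rewrite E. }
  exists a. split.
  - intros r Hr. destruct (H r Hr) as [M [HM _]]. now exists M.
  - intros z. assert (Hz := Cmod_ge_0 z).
    destruct (H (Cmod z + 1)%R ltac:(lra)) as [M [_ HS]].
    apply PSC_unique, HS. lra.
Qed.

(** * The criterion *)

Theorem corollary1p6 (n lambda mu : C)
    (hn : forall m : Z, (m <= 0)%Z -> n <> RtoC (IZR m))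
    (hmu : mu <> RtoC 0) :
  (exists E : C -> C,
      entire E /\ (exists z : C, E z <> RtoC 0) /\ solution n lambda mu E)
  <-> xi (n - 1) lambda mu = RtoC 0.
Proof.
  assert (Hl : forall k, (1 <= k)%nat -> nat_to_C k + (n - 1) <> 0).
  (* [k + (n - 1) = 0] would make [n = 1 - k] an integer at most 0. *)
  { intros k Hk E. apply (hn (1 - Z.of_nat k)%Z); [lia|].
    rewrite minus_IZR, <- INR_IZR_INZ, RtoC_minus.
    replace n with (nat_to_C k + (n - 1) + 1 - nat_to_C k) by ring.
    rewrite E. unfold nat_to_C. ring. }
  split.
  - intros [E [HE [[z Hz] Hsol]]].
    assert (HD : forall z, is_derive E z (C_derive E z)).
    { intros w. apply C_derive_correct; [exact w|apply HE]. }
    destruct (entire_power_series E (C_derive E) HD) as [a [Ha EPS]].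
    { intros w. destruct (Hsol w) as [_ [[d Hd] _]]. eapply is_derive_continuous_C, Hd. }
    assert (EE : E = PSC a) by (apply functional_extensionality; auto).
    subst E.
    assert (Hrec := proj1 (solution_PSC_iff n lambda mu a Ha) Hsol).
    destruct (Ha 1%R (Rle_refl 1)) as [B HB].
    assert (Hx : a O * xi (n - 1) lambda mu = 0).
    { apply (bounded_solution_xi _ _ _ a B); auto.
      intros k. generalize (HB k). rewrite pow1. lra. }
    (* If [xi] were nonzero, [a 0] and hence all coefficients would vanish, contradicting
       [E z <> 0]. *)
    destruct (Ceq_dec (xi (n - 1) lambda mu) 0) as [|Hne]; auto.
    exfalso. apply Hz.
    assert (Ha0 : a O = 0).
    { replace (a O) with (a O * xi (n - 1) lambda mu * / xi (n - 1) lambda mu) by (field; auto).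
      rewrite Hx. ring. }
    assert (H0 := coef_residual_zero _ _ _ a hmu Hrec Ha0).
    apply PSC_unique.
    refine (Cseries_ext _ _ _ _ (fun k => eq_refl) _ (Cseries_head (fun k => a k * z ^ k) _)).
    + cbv beta. rewrite Ha0. ring.
    + intros k. rewrite H0. ring.
  - intros Hxi.
    set (a := fun k => exp_coef mu k * minimal_sol (n - 1) lambda mu k).
    assert (Ha : entire_coef a) by now apply entire_coef_minimal.
    assert (Hrec : forall k, coef_residual (n - 1) lambda mu a k = 0).
    { intros k. now apply coef_residual_minimal. }
    exists (PSC a). split; [|split].
    + intros z. eexists. now apply is_derive_PSC.
    (* The value at 0 is the leading coefficient; its vanishing would annihilate all coefficients,
       whereas some [m_k] is nonzero. *)
    + exists 0. intros E. rewrite PSC_0 in E.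
      destruct (minimal_sol_nonzero (n - 1) lambda mu Hl) as [k Hk].
      apply Hk.
      assert (H0 := coef_residual_zero _ _ _ a hmu Hrec E k). unfold a in H0.
      assert (Hexp : exp_coef mu k <> 0).
      { apply Cmod_gt_0. rewrite Cmod_exp_coef. apply Rdiv_lt_0_compat.
        - now apply pow_lt, Cmod_gt_0.
        - apply INR_fact_lt_0. }
      replace (minimal_sol (n - 1) lambda mu k)
        with (/ exp_coef mu k * (exp_coef mu k * minimal_sol (n - 1) lambda mu k)) by (field; auto).
      rewrite H0. ring.
    + now apply solution_PSC_iff.
Qed.
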